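(* There is a deterministic algorithm that, given an instance of Weighted Gerrymandering (W-GM) in which the input graph is a path, together with a tie-breaking rule $\eta$, decides the instance (under $\eta$) in time $2.619^k (n+m)^{\mathcal{O}(1)}$, where $n=|V(G)|$ and $m=|\mathcal{C}|$.
   Context: Weighted Gerrymandering (W-GM): the input is a graph $G$ on $n$ vertices (voters), a set $\mathcal{C}$ of $m$ candidates, for each voter $v\in V(G)$ a weight function $w_v\colon\mathcal{C}\to\mathbb{Z}^+$, a distinguished candidate $p\in\mathcal{C}$, and a positive integer $k$. A district is a nonempty set $U\subseteq V(G)$ with $G[U]$ connected. A tie-breaking rule $\eta$ assigns to every district $U$ a single candidate $\eta(U)\in\arg\max_{q\in\mathcal{C}}\sum_{v\in U} w_v(q)$, called the winner of $U$. The question is whether $V(G)$ can be partitioned into $k$ pairwise disjoint districts such that $p$ wins strictly more of these districts than any other candidate. *)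

(* Defs.v *)
From HB Require Import structures.
From mathcomp Require Import all_boot all_order all_algebra.
Set Implicit Arguments.
Unset Strict Implicit.
Unset Printing Implicit Defensive.

(** * Weighted Gerrymandering *)

Record wgm_instance := WGM {
  nvoters : nat;
  ncands : nat;
  edge : rel 'I_nvoters;
  edge_sym : symmetric edge;
  edge_irr : irreflexive edge;
  weight : 'I_nvoters -> 'I_ncands -> nat;
  weight_gt0 : forall v q, 0 < weight v q;
  pref : 'I_ncands;
  ndist : nat;
  ndist_gt0 : 0 < ndist }.

Section Problem.
Variable I : wgm_instance.

(* Some duplicate-free enumeration s of all vertices has exactly the pairs of
   consecutive entries as edges. *)
Definition is_path_graph : Prop :=
  0 < nvoters I /\
  exists s : seq 'I_(nvoters I),
    [/\ uniq s, forall v, v \in s &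
        forall u v, edge u v = (index v s == (index u s).+1)
                            || (index u s == (index v s).+1)].

Definition induced_edge (U : {set 'I_(nvoters I)}) : rel 'I_(nvoters I) :=
  [rel u v | [&& u \in U, v \in U & edge u v]].

Definition district (U : {set 'I_(nvoters I)}) : bool :=
  (U != set0) && [forall u in U, forall v in U, connect (induced_edge U) u v].

(* A tie-breaking rule is a total function; only its values on districts are
   constrained, and only those matter for [wgm_yes]. *)
Definition tie_breaking (eta : {set 'I_(nvoters I)} -> 'I_(ncands I)) : Prop :=
  forall U, district U ->
  forall q, \sum_(v in U) weight v q <= \sum_(v in U) weight v (eta U).

Definition wins (eta : {set 'I_(nvoters I)} -> 'I_(ncands I))
    (P : {set {set 'I_(nvoters I)}}) (q : 'I_(ncands I)) : nat :=
  #|[set U in P | eta U == q]|.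

Definition wgm_yes (eta : {set 'I_(nvoters I)} -> 'I_(ncands I)) : bool :=
  [exists P : {set {set 'I_(nvoters I)}},
    [&& partition P setT, #|P| == ndist I, [forall U in P, district U] &
        [forall q, (q != pref I) ==> (wins eta P q < wins eta P (pref I))]]].

End Problem.

(** * Word RAM with an oracle

  Deterministic programs over finitely many registers and a random-access
  memory. Registers and memory cells hold words, i.e. numbers below [2 ^ w];
  arithmetic results are reduced modulo [2 ^ w], and subtraction is truncated
  at 0. Every operator, register or constant occurrence, memory access,
  assignment, test and oracle call takes one time unit. *)

Inductive binop := Add | Sub | Mul | Div | Mod | Lt | Eq.

Inductive expr :=
  | Const of nat
  | Reg of nat
  | Fetch of expr
  | Bin of binop & expr & expr.

Inductive cmd :=
  | Skip
  | Set_ of nat & expr            (* register := value *)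
  | Store of expr & expr          (* memory[address] := value *)
  | Query of nat & expr           (* register := oracle (memory from address) *)
  | Seq of cmd & cmd
  | If of expr & cmd & cmd        (* zero is false, nonzero is true *)
  | While of expr & cmd.

Record state := State { regs : nat -> nat; mem : nat -> nat }.

Definition upd (f : nat -> nat) (i x : nat) : nat -> nat :=
  fun j => if j == i then x else f j.

Definition binop_fun (o : binop) : nat -> nat -> nat :=
  match o with
  | Add => addn | Sub => subn | Mul => muln | Div => divn | Mod => modn
  | Lt => fun x y => x < y
  | Eq => fun x y => x == y
  end.

Fixpoint esize (a : expr) : nat :=
  match a with
  | Const _ | Reg _ => 1
  | Fetch b => (esize b).+1
  | Bin _ b c => (esize b + esize c).+1
  end.

Section Semantics.
Variables (w : nat) (oracle : (nat -> nat) -> nat).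

Fixpoint eval (s : state) (a : expr) : nat :=
  match a with
  | Const c => c %% 2 ^ w
  | Reg r => regs s r
  | Fetch b => mem s (eval s b)
  | Bin o b c => binop_fun o (eval s b) (eval s c) %% 2 ^ w
  end.

(* [exec c s t s']: from [s], command [c] halts in [s'] after exactly [t] time
   units. *)
Inductive exec : cmd -> state -> nat -> state -> Prop :=
  | ExecSkip s : exec Skip s 1 s
  | ExecSet s r a :
      exec (Set_ r a) s (esize a).+1 (State (upd (regs s) r (eval s a)) (mem s))
  | ExecStore s a b :
      exec (Store a b) s (esize a + esize b).+1
           (State (regs s) (upd (mem s) (eval s a) (eval s b)))
  | ExecQuery s r a :
      exec (Query r a) s (esize a).+1
           (State (upd (regs s) r (oracle (fun i => mem s (eval s a + i))))
                  (mem s))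
  | ExecSeq c1 c2 s s1 s2 t1 t2 :
      exec c1 s t1 s1 -> exec c2 s1 t2 s2 -> exec (Seq c1 c2) s (t1 + t2) s2
  | ExecIf a c1 c2 s s' t :
      exec (if eval s a != 0 then c1 else c2) s t s' ->
      exec (If a c1 c2) s ((esize a).+1 + t) s'
  | ExecWhileFalse a c s :
      eval s a = 0 -> exec (While a c) s (esize a).+1 s
  | ExecWhileTrue a c s s1 s2 t1 t2 :
      eval s a != 0 -> exec c s t1 s1 -> exec (While a c) s1 t2 s2 ->
      exec (While a c) s ((esize a).+1 + t1 + t2) s2.

Lemma exec_det c s t1 s1 t2 s2 :
  exec c s t1 s1 -> exec c s t2 s2 -> t1 = t2 /\ s1 = s2.
Proof.
move=> H; elim: H t2 s2 => {c s t1 s1}; intros;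
  match goal with H : exec _ _ ?t ?s |- _ = ?t /\ _ = ?s => inversion H; subst end;
  repeat match goal with
  | IH : forall t s, exec ?c ?x t s -> _ , H : exec ?c ?x _ _ |- _ =>
      case: (IH _ _ H) => ? ?; clear IH H; subst
  end; try by [];
  match goal with H : eval ?s ?a = 0, H' : is_true (eval ?s ?a != 0) |- _ =>
    by rewrite H in H' end.
Qed.

End Semantics.

(** * Input and oracle of an instance *)

(* Matrices are stored row by row. *)
Definition encode (I : wgm_instance) : seq nat :=
  [:: nvoters I; ncands I; val (pref I); ndist I]
  ++ [seq nat_of_bool (edge u v)
       | u <- enum 'I_(nvoters I), v <- enum 'I_(nvoters I)]
  ++ [seq weight v q | v <- enum 'I_(nvoters I), q <- enum 'I_(ncands I)].

Definition init (I : wgm_instance) : state :=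
  State (fun=> 0) (nth 0 (encode I)).

(* The queried vertex set is given by its characteristic vector. *)
Definition eta_oracle (I : wgm_instance)
    (eta : {set 'I_(nvoters I)} -> 'I_(ncands I)) (f : nat -> nat) : nat :=
  val (eta [set v : 'I_(nvoters I) | f v != 0]).

(* Main.v *)
(** Fix the number h of districts that p is to win; each other candidate may
    then win at most h - 1 of the remaining d = k - h districts. Give each other
    candidate h - 1 integers ("points") of its own, and label every district
    that p does not win with a point of its winner. The instance is positive iff
    for some h there is a sequence of cuts with a labelling by pairwise distinct
    points, i.e. iff the sum of the squared Vandermonde products V(w)^2 over all
    labellings w is nonzero: its terms are nonnegative, so nothing cancels.

    For a word w put E_w(t) = prod_(a in w) (t - a). Then
    V(a :: w)^2 = E_w(a)^2 V(w)^2 and E_(a :: w)(t) = (t - a) E_w(t), so the sums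
    of V(w)^2 prod_(t in T) E_w(t) over the labellings w of a prefix of the path
    satisfy a recursion which lengthens w by one and shortens the multiset T by
    two. As E_w has degree |w|, interpolation expresses E_w(a) through the values
    at |w| + 1 integer nodes, and it suffices to take T of size 2 (d - |w|) over
    the nodes 0, ..., |w| + 1. Such a T is a word of stars (of length 1) and bars
    (of length 2) with total length 2 d + 2; hence there are only O(phi^(2 d))
    of them, where phi^2 = 2.618... is the square of the golden ratio.

    The sums are computed modulo all small integers. A positive N < 2^h is not
    divisible by all integers up to 2 h, because h * 'C(2 h, h) divides every
    common multiple of these. *)
Require Import Defs.
From HB Require Import structures.
From mathcomp Require Import all_boot all_order all_algebra.
From mathcomp Require Import zify ring lra.
Set Implicit Arguments.
Unset Strict Implicit.
Unset Printing Implicit Defensive.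

(** * Words of stars and bars *)

(** The sums are bounded only by 2^(6 (n + m)^3), more than a word is guaranteed to hold, hence the
    residues. Letting the moduli run through all small integers avoids the need for primes, but most
    moduli are then composite, so interpolation must not divide. It is done with binomial
    coefficients and finite differences, and the recursion is proved over an arbitrary commutative
    ring.

    What keeps the table at a single factor phi^(2 k) is an invariant: dropping a label removes one
    bar and inserts two stars, and interpolating at the top node only moves a star. So for fixed h
    all words have length 2 (k - h) + 2, and the number of bars tells how many labels remain.

    No program is timed by hand. The algorithm is written as terms over tables, with one general
    compiler; a syntactic check assigns to each term a power of B = n + m and at most one factor U =
    fib (2 k + 4), and the resulting exponent of B goes into the polynomial factor. *)

Fixpoint fib (n : nat) : nat :=
  if n is (m.+1 as p).+1 then fib p + fib m else n.

Arguments fib : simpl never.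

Lemma fibSS n : fib n.+2 = fib n.+1 + fib n. Proof. by []. Qed.

Lemma leq_fib m n : m <= n -> fib m <= fib n.
Proof.
move=> /subnK <-; elim: (n - m) => // k IH; apply: leq_trans IH _.
by rewrite addSn; case: (k + m) => // l; rewrite fibSS leq_addr.
Qed.

Lemma fib_gt0 n : 0 < fib n.+1.
Proof. exact: (@leq_fib 1). Qed.

Section FibBound.
Import GRing.Theory Num.Theory.
Local Open Scope ring_scope.

Lemma litE : 2.619%Q = 2619%:R / 1000%:R :> rat.
Proof. by rewrite -[LHS]divr1; apply/eqP; rewrite rat_eqE; vm_compute. Qed.

(* 89 / 55 is a rational x above the golden ratio, so that x + 1 <= x ^+ 2,
   with still x ^+ 2 <= 2.619. *)
Lemma fib_exp (n : nat) : (fib n)%:R <= (89%:R / 55%:R) ^+ n :> rat.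
Proof.
have hx : 89%:R / 55%:R + 1 <= 89%:R / 55%:R * (89%:R / 55%:R) :> rat by lra.
have hx0 : 0 <= 89%:R / 55%:R :> rat by lra.
have hx1 : 1 <= 89%:R / 55%:R :> rat by lra.
move: (89%:R / 55%:R) hx hx0 hx1 => x hx hx0 hx1.
have H : (fib n)%:R <= x ^+ n :> rat /\ (fib n.+1)%:R <= x ^+ n.+1 :> rat.
  elim: n => [|n [h1 h2]]; first by rewrite expr1.
  split=> //; rewrite fibSS natrD.
  apply: Order.le_trans (lerD h2 h1) _; rewrite !exprSr.
  have -> : x ^+ n * x + x ^+ n = x ^+ n * (x + 1) by ring.
  by rewrite -mulrA; apply: ler_wpM2l => //; apply: exprn_ge0.
by case: H.
Qed.

(** The surplus 4 in the index costs (89 / 55)^4 < 8. The factor 8 is later absorbed by three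
    factors n + m, each at least 2. *)
Lemma fib_bound (k : nat) : (fib (2 * k + 4))%:R <= 2.619%Q ^+ k * 8%:R :> rat.
Proof.
have := litE; move: 2.619%Q => q eq.
have h1 := fib_exp (2 * k + 4).
have h0 : 0 <= 89%:R / 55%:R :> rat by lra.
have h2 : (89%:R / 55%:R) ^+ 2 <= q by rewrite eq expr2; lra.
have h4 : (89%:R / 55%:R) ^+ 4 <= 8%:R :> rat by lra.
move: (89%:R / 55%:R) h0 h1 h2 h4 => x h0 h1 h2 h4.
have h5 : 0 <= q := Order.POrderTheory.le_trans (exprn_ge0 2 h0) h2.
apply: (Order.le_trans h1); rewrite exprD exprM; move: 8%:R h4 => z h4.
have hk : (x ^+ 2) ^+ k <= q ^+ k.
  by apply: lerXn2r h2; rewrite nnegrE; [exact: (exprn_ge0 2 h0)|exact: h5].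
exact: (ler_pM (exprn_ge0 k (exprn_ge0 2 h0)) (exprn_ge0 4 h0) hk h4).
Qed.
End FibBound.

(* In a word, [true] is a bar, of length 2, and [false] is a star, of length 1.
   A star stands for the node numbered by the bars to its right. The code [enc]
   numbers the words of each length; it increases with the leading stars, so
   that [walk_sum_star] refers to words with smaller codes. *)
Fixpoint wlen (u : seq bool) := if u is b :: v then (if b then 2 else 1) + wlen v else 0.
Fixpoint bars (u : seq bool) := if u is b :: v then b + bars v else 0.
Fixpoint enc (u : seq bool) :=
  if u is b :: v then (if b then 0 else fib (wlen v)) + enc v else 0.
Fixpoint ins s (u : seq bool) :=
  if bars u == s then false :: u else if u is b :: v then b :: ins s v else [::].

(** The bound is the number of words of this length. Among the words of length l, those with a
    leading bar have codes below [fib (l - 1)] and those with a leading star have codes from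
    [fib (l - 1)] on; the program decodes words by this test. *)
Lemma enc_lt u : enc u < fib (wlen u).+1.
Proof.
elim: u => //= -[] v IH.
  by rewrite add0n; apply: leq_trans IH _; apply: leq_fib; lia.
by rewrite add1n fibSS addnC ltn_add2r.
Qed.

Lemma bars_wlen u : 2 * bars u <= wlen u.
Proof. by elim: u => //= -[] v; lia. Qed.

Lemma bars_nseq d : bars (nseq d true) = d.
Proof. by elim: d => //= d ->; rewrite add1n. Qed.

Lemma wlen_nseq d : wlen (nseq d true) = 2 * d.
Proof. by elim: d => //= d ->; lia. Qed.

Lemma enc_nseq d : enc (nseq d true) = 0.
Proof. by elim: d. Qed.

Lemma bars_ins s u : bars (ins s u) = bars u.
Proof. by elim: u => [|b v IH]; rewrite /=; case: (_ == s) => //=; rewrite IH. Qed.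

Lemma wlen_ins s u : s <= bars u -> wlen (ins s u) = (wlen u).+1.
Proof.
elim: u => [|b v IH] /=; first by rewrite leqn0 => /eqP ->.
case: eqP => [_ _|ne le] /=; first by [].
rewrite IH; last by case: b ne le => /=; lia.
by rewrite addnS.
Qed.

(** The right-hand side is the code of [false :: u], a word of the same length. Trading its leading
    star for one at a lower node thus decreases the code, which makes the recursion of
    [walk_sum_star] well founded. *)
Lemma enc_ins s u : s < bars u -> enc (ins s u) < fib (wlen u) + enc u.
Proof.
elim: u => [|b v IH] //= lts; rewrite gtn_eqF //=.
case: b lts => /= lts.
  rewrite add0n; apply: leq_trans (enc_lt _) _.
  by rewrite wlen_ins ?add2n ?leq_addr // -ltnS.
by rewrite add0n in lts; rewrite (wlen_ins (ltnW lts)) ltn_add2l IH.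
Qed.

(** * Division-free interpolation at the nodes 0, 1, 2, .. *)

Section Ring.
Import GRing.Theory.
Local Open Scope ring_scope.
Variable R : comNzRingType.
Implicit Types (w : seq nat) (u : seq bool).

(** This is E_w(t) of the overview; [vdm_sq] is V(w)^2, and [star_prod] is the product of E_w over
    the multiset T of nodes that the stars of [u] stand for. *)
Definition root_prod w (t : nat) : R := \prod_(a <- w) (t%:R - a%:R).

Fixpoint star_prod w u : R :=
  if u is b :: v then (if b then 1 else root_prod w (bars v)) * star_prod w v else 1.

Fixpoint vdm_sq w : R := if w is a :: v then root_prod v a ^+ 2 * vdm_sq v else 1.

Lemma star_prod_nil u : star_prod [::] u = 1.
Proof. by elim: u => //= b v ->; rewrite /root_prod big_nil mulr1; case: b. Qed.

Lemma star_prod_cons a w u : star_prod (a :: w) u = star_prod [:: a] u * star_prod w u.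
Proof.
elim: u => /= [|b v ->]; first by rewrite mulr1.
case: b; first by rewrite !mul1r.
rewrite /root_prod !big_cons big_nil mulr1; ring.
Qed.

Lemma star_prod_ins w s u : (s <= bars u)%N -> star_prod w (ins s u) = root_prod w s
  * star_prod w u.
Proof.
elim: u => [|b v IH] /=; first by rewrite leqn0 => /eqP ->.
case: eqP => [<- //|ne le] /=.
rewrite bars_ins IH; last by case: b ne le => /=; lia.
ring.
Qed.

Definition sgn (e : nat) : R := (-1) ^+ e.

(** The coefficient of f(s) when Newton's forward difference formula through 0, ..., d - 1 is
    evaluated at a. Unlike Lagrange's quotients it is visibly an integer, so it makes sense modulo
    composite numbers. *)
Definition lag d a s : R :=
  \sum_(r < d) sgn (r + s) * ('C(a, r)%:R * 'C(r, s)%:R).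

Definition finite_diff (f : nat -> R) r := \sum_(s < r.+1) sgn (r + s) * 'C(r, s)%:R * f s.

Lemma finite_diffS f r : finite_diff f r.+1 = finite_diff (fun s => f s.+1 - f s) r.
Proof.
rewrite /finite_diff /sgn big_ord_recl /= bin0.
under eq_bigr => s _ do rewrite /bump /= add1n binS natrD.
pose g s := (-1) ^+ (r + s) * 'C(r, s)%:R * f s.+1 : R.
pose h s := (-1) ^+ (r + s) * 'C(r, s)%:R * f s : R.
have -> : \sum_(i < r.+1) (-1) ^+ (r + i) * 'C(r, i)%:R * (f i.+1 - f i) =
    \sum_(i < r.+1) g i - \sum_(i < r.+1) h i.
  by rewrite -sumrB; apply: eq_bigr => i _; rewrite /g /h mulrBr.
have -> : \sum_(i < r.+1) (-1) ^+ (r.+1 + i.+1) * ('C(r, i.+1)%:R + 'C(r, i)%:R) * f i.+1 =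
    \sum_(i < r.+1) g i - \sum_(i < r.+1) h i.+1.
  rewrite -sumrB; apply: eq_bigr => i _; rewrite /g /h.
  by rewrite addSn !addnS !exprS; ring.
have e1 : \sum_(i < r.+1) h i = h 0%N + \sum_(i < r.+1) h i.+1.
  have h0 : h r.+1 = 0 by rewrite /h bin_small // mulr0 mul0r.
  have e : \sum_(i < r.+2) h i = \sum_(i < r.+1) h i by rewrite big_ord_recr /= h0 addr0.
  by rewrite -e big_ord_recl.
by rewrite e1 /h bin0 addSn exprS; ring.
Qed.

(** Differences at 0 are dual to the binomial basis: by Pascal's rule, one difference step lowers
    both [r] and [m]. *)
Lemma finite_diff_bin m r : finite_diff (fun s => 'C(s, m)%:R) r = (r == m)%:R.
Proof.
elim: r m => [|r IH] m.
  by rewrite /finite_diff big_ord1 /sgn bin0 !mul1r; case: m.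
rewrite finite_diffS; case: m => [|m].
  by rewrite /finite_diff big1 // => i _; rewrite !bin0 subrr mulr0.
rewrite eqSS -IH; apply: eq_bigr => i _; rewrite binS natrD; ring.
Qed.

Lemma lag_finite_diff (f : nat -> R) d a : \sum_(s < d) lag d a s * f s = \sum_(r <
  d) 'C(a, r)%:R * finite_diff f r.
Proof.
under eq_bigr => s _ do rewrite /lag mulr_suml.
rewrite exchange_big /=; apply: eq_bigr => r _; rewrite /finite_diff mulr_sumr.
rewrite (big_ord_widen d (fun s => 'C(a, r)%:R * (sgn (r + s) * 'C(r, s)%:R * f s))) //.
rewrite [RHS]big_mkcond; apply: eq_bigr => s _; case: ltnP => [_|lt]; first by ring.
by rewrite (@bin_small r s) // !mulr0 mul0r.
Qed.

(** A stand-in for being a polynomial of degree below [d]. In the binomial basis finite differences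
    recover the coefficients without division. *)
Definition newton d (f : nat -> R) :=
  exists c : nat -> R, forall a, f a = \sum_(r < d) c r * 'C(a, r)%:R.

(** Multiplication by a - b raises the degree by one in the binomial basis, because a 'C(a, r) = r
    'C(a, r) + (r + 1) 'C(a, r + 1). *)
Lemma root_prod_newton w : newton (size w).+1 (root_prod w).
Proof.
elim: w => [|b w [c hc]].
  by exists (fun=> 1) => a; rewrite /root_prod big_nil big_ord1 bin0 mulr1.
(* Nothing is known of [c] beyond index [size w]; the factor [(r <= size w)] removes its value at
   the new top index. *)
exists (fun r => c r * (r <= size w)%:R * (r%:R - b%:R) + (if r is q.+1 then c q *
  r%:R else 0)) => a.
rewrite /root_prod big_cons -/(root_prod w a) hc /=.
pose g r := c r * (r%:R - b%:R) * 'C(a, r)%:R : R.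
pose h r := c r * r.+1%:R * 'C(a, r.+1)%:R : R.
have -> : (a%:R - b%:R) * (\sum_(r < (size w).+1) c r * 'C(a, r)%:R) =
    \sum_(r < (size w).+1) g r + \sum_(r < (size w).+1) h r.
  rewrite -big_split mulr_sumr; apply: eq_bigr => r _; rewrite /g /h /=.
  have : a%:R * 'C(a, r)%:R = r%:R * 'C(a, r)%:R + r.+1%:R * 'C(a, r.+1)%:R :> R.
    rewrite -!natrM -natrD; congr _%:R.
    case: (ltnP a r) => [lt|le]; first by rewrite !bin_small ?muln0 // ltnW.
    rewrite mul_bin_left -{1}(subnKC le) mulnDl addnC; lia.
  move: 'C(a, r)%:R 'C(a, r.+1)%:R => x y e.
  by rewrite mulrCA mulrBl e; ring.
under [RHS]eq_bigr => r _ do rewrite mulrDl.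
rewrite big_split /=; congr (_ + _).
  rewrite [RHS]big_ord_recr /= ltnn mulr0 !mul0r addr0.
  by apply: eq_bigr => r _; rewrite -ltnS ltn_ord mulr1.
by rewrite [RHS]big_ord_recl mul0r add0r.
Qed.

Lemma interpolation w d a : (size w < d)%N ->
  root_prod w a = \sum_(s < d) lag d a s * root_prod w s.
Proof.
move=> lt; rewrite lag_finite_diff; have [c hc] := root_prod_newton w.
pose c' r := if (r < (size w).+1)%N then c r else 0.
have hc' b : root_prod w b = \sum_(r < d) c' r * 'C(b, r)%:R.
  rewrite hc (big_ord_widen d (fun r => c r * 'C(b, r)%:R)) // [LHS]big_mkcond.
  by apply: eq_bigr => r _; rewrite /c'; case: ifP; rewrite ?mul0r.
rewrite hc'; apply: eq_bigr => r _; rewrite mulrC; congr (_ * _).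
have -> : finite_diff (root_prod w) r = \sum_(q < d) c' q * finite_diff (fun s =>
  'C(s, q)%:R) r.
  rewrite /finite_diff; under [RHS]eq_bigr => q _ do rewrite mulr_sumr.
  rewrite exchange_big /=; apply: eq_bigr => s _; rewrite hc' mulr_sumr.
  by apply: eq_bigr => q _; ring.
rewrite (bigD1 r) //= finite_diff_bin eqxx mulr1 big1 ?addr0 // => q ne.
rewrite finite_diff_bin (_ : (_ == _) = false) ?mulr0 //.
by apply: contraNF ne => /eqP/ord_inj ->.
Qed.

End Ring.

(** * Small integers that do not divide a given number *)

(* In Leibniz's harmonic triangle [1 / (m * 'C(n, m))] is, for [1 < m], the
   difference of two entries with index [m - 1]. *)
Lemma leibniz N n : (forall j, 0 < j <= n -> j %| N) ->
  forall m, 0 < m <= n -> m * 'C(n, m) %| N.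
Proof.
move=> hn m; elim: m n hn => [//|[|m] IH] n hn /andP[_ le].
  by rewrite bin1 mul1n; apply: hn; rewrite le leqnn.
have hn' j : 0 < j <= n.-1 -> j %| N by move=> h; apply: hn; lia.
have /dvdnP[x hx] := IH n.-1 hn' ltac:(lia).
have /dvdnP[y hy] := IH n hn ltac:(lia).
case: n le hn {hn'} hx hy => // n le hn /=; set a := _ * 'C(n, _); set b := _ *
  'C(n.+1, _) => hx hy.
set c := _ * _.
have hb : b = a + m.+1 * 'C(n, m) by rewrite /b binS mulnDr.
have hab : a * b = c * (m.+1 * 'C(n, m)).
  by rewrite /a /b /c -!(mul_bin_diag n.+1) /= mulnACA [m.+1 * _]mulnC mulnACA.
have hd : 0 < m.+1 * 'C(n, m) by rewrite muln_gt0 bin_gt0; lia.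
apply/dvdnP; exists (x - y); apply/eqP; rewrite -(eqn_pmul2r hd); apply/eqP.
rewrite -mulnA -hab mulnBl [y * _]mulnCA -hy [x * _]mulnA -hx [a * N]mulnC -mulnBr hb.
by congr (_ * _); lia.
Qed.

Lemma bin_exp h : 2 ^ h <= 'C(2 * h, h).
Proof.
elim: h => // h IH; rewrite expnS mulnS binS.
have -> : 'C((2 * h).+1, h.+1) = 'C((2 * h).+1, h) by rewrite -bin_sub //; [congr
  'C(_, _)|]; lia.
rewrite addnn -mul2n leq_mul2l /=; apply: leq_trans IH _.
exact: leq_bin2l.
Qed.

Lemma small_nondivisor N h : 0 < N -> N < 2 ^ h ->
  exists2 mu, mu < 2 * h & ~~ (mu.+1 %| N).
Proof.
move=> N0 ltN; case: h ltN => [|h ltN]; first by rewrite expn0; case: N N0.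
case: (boolP [forall mu : 'I_(2 * h.+1), mu.+1 %| N]) => [/forallP hall|].
  have : h.+1 * 'C(2 * h.+1, h.+1) %| N.
    apply: leibniz => [j /andP[j0 lej]|]; last by lia.
    case: j j0 lej => // j _ lej; exact: (hall (Ordinal lej)).
  move=> /(dvdn_leq N0); rewrite leqNgt => /negP[]; apply: leq_trans ltN _.
  by apply: leq_trans (bin_exp _) _; rewrite leq_pmull.
by rewrite negb_forall => /existsP[mu hmu]; exists mu.
Qed.

(** * Weighted sums over walks *)

Section Words.
Variables (col : nat -> nat -> nat) (p kap : nat).

Definition pts q := [seq q * kap + c | c <- iota 0 kap].

(* [words i j d] lists the labellings of the first [i] vertices cut into [j]
   districts won by [p] and [d] others, the last district coming first; the points
   of candidate [q] are [pts q]. *)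
Definition ext (W : nat -> nat -> nat -> seq (seq nat)) i i' j d :=
  if col i' i == p then if j is j'.+1 then W i' j' d else [::]
  else if d is d'.+1 then [seq a :: w | a <- pts (col i' i), w <- W i' j d']
  else [::].

Fixpoint wordsf f i j d : seq (seq nat) :=
  if f is f'.+1 then
    if i == 0 then nseq ((j == 0) && (d == 0)) [::]
    else flatten [seq ext (wordsf f') i i' j d | i' <- iota 0 i]
  else [::].

Definition words i := wordsf i.+1 i.

Lemma wordsf_irr f i j d : i < f -> wordsf f i j d = words i j d.
Proof.
rewrite /words; elim/ltn_ind: i f j d => i IH [//|f] j d; rewrite ltnS => lef /=.
case: eqP => // _; congr flatten; apply/eq_in_map => i'; rewrite mem_iota add0n => /= lti.
rewrite /ext; case: ifP => _.
  case: j => // j; rewrite (IH i' lti f) ?(IH i' lti i) //.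
  exact: leq_trans lef.
case: d => // d; rewrite (IH i' lti f) ?(IH i' lti i) //.
exact: leq_trans lef.
Qed.

Lemma words0 j d : words 0 j d = nseq ((j == 0) && (d == 0)) [::].
Proof. by []. Qed.

Lemma wordsS i j d : 0 < i ->
  words i j d = flatten [seq ext words i i' j d | i' <- iota 0 i].
Proof.
case: i => // i _.
transitivity (flatten [seq ext (wordsf i.+1) i.+1 i' j d | i' <- iota 0 i.+1]) => //.
congr flatten; apply/eq_in_map => i'; rewrite mem_iota => /andP[_ lti]; rewrite /ext.
case: ifP => _; first by case: j => // j; apply: wordsf_irr.
by case: d => // d; rewrite -(wordsf_irr j d lti).
Qed.

Lemma size_words i j d w : w \in words i j d -> size w = d.
Proof.
elim/ltn_ind: i j d w => i IH j d w; case: (posnP i) => [->|i0].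
  by rewrite words0; case: eqP => _ //=; case: eqP => // ->; rewrite inE => /eqP ->.
rewrite wordsS // => /flatten_mapP[i']; rewrite mem_iota add0n => /= lti.
rewrite /ext; case: ifP => _; first by case: j => // j; apply: IH.
case: d => // d /allpairsP[[a v] [_ /= hv ->]] /=.
by rewrite (IH _ lti _ _ _ hv).
Qed.

Section Val.
Import GRing.Theory.
Local Open Scope ring_scope.
Variable R : comNzRingType.

(* A word with [e] bars has the nodes [0, ..., e] and goes with labellings of length
   [e - 1]; its top node is one more than interpolation needs. *)
Definition walk_sum i j u : R :=
  \sum_(w <- words i j (bars u).-1) vdm_sq R w * star_prod R w u.

Lemma walk_sum0 j u : walk_sum 0 j (true :: u) = ((j == 0%N) && (bars u == 0%N))%:R.
Proof.
rewrite /walk_sum words0 /=; case: (_ && _); last by rewrite big_nil.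
by rewrite big_seq1 /= star_prod_nil !mul1r.
Qed.

(** The sum is split by the last district, from [i'] to [i]. If its label is a, the stars of [u]
    contribute [star_prod [:: a] u], and E_w(a)^2 is interpolated twice, at nodes [s1] and [s2] that
    become new stars. Labellings of length [bars u - 1] need exactly the nodes below [bars u]; two
    stars replace the leading bar, so the length is kept. *)
Lemma walk_sumS i j u : (0 < i)%N ->
  walk_sum i j (true :: u) =
  \sum_(i' < i) if col i' i == p then (if j is j'.+1 then walk_sum i' j' (true :: u) else 0)
    else \sum_(c < kap) star_prod R [:: col i' i * kap + c]%N u *
      \sum_(s1 < bars u) \sum_(s2 < bars u)
        lag R (bars u) (col i' i * kap + c) s1 * lag R (bars u) (col i' i * kap + c) s2
        * walk_sum i' j (ins s1 (ins s2 u)).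
Proof.
move=> i0; rewrite {1}/walk_sum wordsS // big_flatten big_map -{1}(subn0 i) big_mkord.
apply: eq_bigr => i' _; rewrite /ext; case: ifP => _.
  by case: j => [|j]; rewrite ?big_nil.
rewrite (_ : (bars (true :: u)).-1 = bars u) //; set d := bars u; case Ed: d => [|d'].
  by rewrite big_nil big1 // => c _; rewrite big_ord0 mulr0.
rewrite big_allpairs_dep big_map -{1}(subn0 kap) big_mkord; apply: eq_bigr => c _.
set a := (_ + c)%N; rewrite -Ed.
transitivity (star_prod R [:: a] u * \sum_(w <- words i' j d') root_prod R w a *
  root_prod R w a * (vdm_sq R w * star_prod R w u)).
  rewrite mulr_sumr; apply: eq_bigr => w _ /=; rewrite star_prod_cons expr2 mul1r; ring.
congr (_ * _); rewrite /walk_sum; have hd : d.-1 = d' by rewrite Ed.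
under [RHS]eq_bigr => s1 _ do under eq_bigr => s2 _ do rewrite !bars_ins -/d hd mulr_sumr.
under [RHS]eq_bigr => s1 _ do rewrite exchange_big /=.
rewrite exchange_big /= big_seq [RHS]big_seq; apply: eq_bigr => w hw.
have sw : (size w < d)%N by rewrite (size_words hw) Ed.
rewrite {1}(interpolation R a sw) (interpolation R a sw) mulr_suml mulr_suml.
apply: eq_bigr => s1 _; rewrite mulr_sumr mulr_suml; apply: eq_bigr => s2 _.
rewrite !star_prod_ins ?bars_ins -/d ?(ltnW (ltn_ord _)) //; ring.
Qed.

(** The leading star stands for the top node [bars u]. As the labellings have length [bars u - 1],
    the value of E_w there is a combination of its values at the lower nodes. *)
Lemma walk_sum_star i j u : (0 < bars u)%N ->
  walk_sum i j (false :: u) =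
  \sum_(s < bars u) lag R (bars u) (bars u) s * walk_sum i j (ins s u).
Proof.
move=> u0; rewrite /walk_sum /= add0n.
under [RHS]eq_bigr => s _ do rewrite bars_ins mulr_sumr.
rewrite exchange_big /= big_seq [RHS]big_seq; apply: eq_bigr => w hw.
have sw : (size w < bars u)%N by rewrite (size_words hw) prednK.
rewrite (interpolation R (bars u) sw) mulr_suml mulr_sumr; apply: eq_bigr => s _.
rewrite star_prod_ins ?(ltnW (ltn_ord _)) //; ring.
Qed.

Lemma star_prod_bars w d : star_prod R w (nseq d true) = 1.
Proof. by elim: d => //= d ->; rewrite mul1r. Qed.

End Val.

Lemma mem_pts q a : (a \in pts q) = (0 < kap) && (a %/ kap == q).
Proof.
apply/mapP/andP => [[c]|[k0 /eqP <-]].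
  rewrite mem_iota add0n => /= ltc ->; have k0 : 0 < kap by apply: leq_ltn_trans ltc.
  by rewrite divnMDl // (divn_small ltc) addn0.
by exists (a %% kap); rewrite ?mem_iota ?add0n ?ltn_mod -?divn_eq.
Qed.

Definition colors cs := pairmap col 0 cs.

Lemma colors_rcons cs i : colors (rcons cs i) = rcons (colors cs) (col (last 0 cs) i).
Proof. by rewrite /colors -!cats1 pairmap_cat. Qed.

Definition others (s : seq nat) := [seq q <- s | q != p].

(** Here [cs] lists the right ends of the districts; their colors are reversed because the last
    district comes first in [w]. The alternative [(w == [::]) || (0 < kap)] is needed since
    [a %/ 0 = 0]: without points, any number would pass for a point of candidate 0. *)
Lemma wordsP i j d w :
  reflect (exists cs, [/\ path ltn 0 cs, last 0 cs = i, count_mem p (colors cs) = j,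
      size w = d & (w == [::]) || (0 < kap) /\
      [seq a %/ kap | a <- w] = rev (others (colors cs))])
    (w \in words i j d).
Proof.
apply: (iffP idP) => [|[cs]].
- elim/ltn_ind: i j d w => i IH j d w; case: (posnP i) => [->|i0].
    rewrite words0; case: eqP => [->|//]; case: eqP => [->|//] /=; rewrite inE => /eqP ->.
    by exists [::].
  rewrite wordsS // => /flatten_mapP[i']; rewrite mem_iota add0n => /= lti.
  rewrite /ext; case: ifP => [cp|cp].
    case: j => // j /(IH _ lti) [cs [h1 h2 h3 h4 [h5 h6]]]; exists (rcons cs i).
    rewrite rcons_path last_rcons h1 h2 /= lti colors_rcons h2 -cats1 count_cat /= cp h3 h4.
    by rewrite addnC h5 /others filter_cat /= cp cats0.
  case: d => // d /allpairsP[[a v] [/= ha hv ->]].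
  have [cs [h1 h2 h3 h4 [h5 h6]]] := IH _ lti _ _ _ hv; exists (rcons cs i).
  move: ha; rewrite mem_pts => /andP[k0 /eqP ha].
  rewrite rcons_path last_rcons h1 h2 /= lti colors_rcons h2 -cats1 count_cat /= cp h3 h4.
  by rewrite !addn0 k0 /others filter_cat /= cp cats1 rev_rcons /= ha h6.
- elim/last_ind: cs i j d w => [|cs c IH] i j d w [h1 h2 h3 h4 [h5 h6]].
    by rewrite -h2 -h3 -h4 words0; case: w h6 {h4 h5} => // _; rewrite inE.
  rewrite last_rcons in h2; rewrite {c}h2 in h1 h3 h6 *.
  rewrite rcons_path in h1; case/andP: h1 => h1 lti.
  rewrite colors_rcons in h3 h6.
  have i0 : 0 < i by apply: leq_ltn_trans lti.
  rewrite wordsS //; apply/flatten_mapP; exists (last 0 cs).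
    by rewrite mem_iota add0n.
  move: h3 h6; rewrite /ext -cats1 count_cat /others filter_cat /=.
  case: (eqVneq (col (last 0 cs) i) p) => cp /=.
    rewrite addnC cats0 => <- h6; apply: IH; split=> //.
  rewrite !addn0 cats1 rev_rcons => h3; case: w h4 h5 => // a w /= h4 h5 [ha h6].
  rewrite -h4; apply/allpairsP; exists (a, w); split=> //=.
    by rewrite mem_pts ha eqxx andbT.
  by apply: IH; split=> //; rewrite -?h3 ?(orP _) ?h5 ?orbT.
Qed.

End Words.

(** * Distinct points as a bound on the number of wins *)

Section Labels.
Variable kap : nat.

(** Counting from the right and from 0, the c-th occurrence of [q] receives the c-th point of
    [q]. *)
Fixpoint label (s : seq nat) : seq nat :=
  if s is q :: s' then (q * kap + count_mem q s') :: label s' else [::].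

Lemma label_bound s a : (forall q, count_mem q s <= kap) -> a \in label s ->
  a %% kap < count_mem (a %/ kap) s.
Proof.
elim: s => //= q s IH hs; rewrite inE => /orP[/eqP ->|ha].
  have lt : count_mem q s < kap by have := hs q; rewrite eqxx.
  have k0 : 0 < kap by apply: leq_ltn_trans lt.
  by rewrite modnMDl (modn_small lt) divnMDl // (divn_small lt) addn0 eqxx.
apply: leq_trans (leq_addl _ _); apply: IH => // r.
exact: leq_trans (leq_addl _ _) (hs r).
Qed.

Lemma labelP s : (forall q, count_mem q s <= kap) ->
  uniq (label s) /\ [seq a %/ kap | a <- label s] = s.
Proof.
elim: s => //= q s IH hs.
have hs' r : count_mem r s <= kap by apply: leq_trans (leq_addl _ _) (hs r).
have lt : count_mem q s < kap by have := hs q; rewrite eqxx.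
have k0 : 0 < kap by apply: leq_ltn_trans lt.
have [-> ->] := IH hs'; rewrite andbT divnMDl // (divn_small lt) addn0; split=> //.
apply/negP => /(label_bound hs').
by rewrite modnMDl (modn_small lt) divnMDl // (divn_small lt) addn0 ltnn.
Qed.

Lemma uniq_count w q : 0 < kap -> uniq w ->
  count_mem q [seq a %/ kap | a <- w] <= kap.
Proof.
move=> k0 uw; rewrite count_map -size_filter.
rewrite -[X in _ <= X](size_iota 0) -(size_map (fun c => q * kap + c) (iota 0 kap)).
apply: uniq_leq_size; first by rewrite filter_uniq.
move=> a; rewrite mem_filter /= => /andP[/eqP e _].
by rewrite -[map _ _]/(pts kap q) mem_pts k0 e eqxx.
Qed.

End Labels.

Lemma count_others p q s : count_mem q (others p s) = (q != p) * count_mem q s.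
Proof.
rewrite /others count_filter; elim: s => [|x s IH] /=; first by rewrite muln0.
rewrite IH mulnDr; congr (_ + _).
by case: (eqVneq x q) => [->|_] /=; rewrite ?muln0 //; case: (_ == _).
Qed.

(** A candidate has only [kap] points, so distinct labels cap its wins at [kap] by the pigeonhole
    principle; conversely [label] numbers the wins of each candidate. *)
Lemma uniq_wordP col p kap i j d :
  (exists2 w, w \in words col p kap i j d & uniq w) <->
  (exists cs, [/\ path ltn 0 cs, last 0 cs = i, count_mem p (colors col cs) = j,
     size (others p (colors col cs)) = d &
     forall q, q != p -> count_mem q (colors col cs) <= kap]).
Proof.
split=> [[w /wordsP [cs [h1 h2 h3 h4 [h5 h6]]] uw]|[cs [h1 h2 h3 h4 h5]]].
  exists cs; split=> //; first by rewrite -size_rev -h6 size_map h4.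
  move=> q qp; have := count_others p q (colors col cs); rewrite qp mul1n => <-.
  rewrite -count_rev -h6; case/orP: h5 => [/eqP -> //|k0]; exact: uniq_count.
have hc q : count_mem q (rev (others p (colors col cs))) <= kap.
  by rewrite count_rev count_others; case: eqVneq => //= qp; rewrite mul1n h5.
have [ul ml] := labelP hc; exists (label kap (rev (others p (colors col cs)))) => //.
apply/wordsP; exists cs; split=> //.
  by rewrite -(size_map (fun a => a %/ kap)) ml size_rev.
split=> //; case: (posnP kap) => [k0|]; last by rewrite orbT.
case: (rev _) hc => //= q s /(_ q); by rewrite k0 eqxx.
Qed.

(** * Positivity and size of the integer sums *)

Section Positive.
Import GRing.Theory Num.Theory.
Local Open Scope ring_scope.

Lemma root_prod_eq0 w a : (root_prod int w a == 0) = (a \in w).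
Proof.
elim: w => [|b w IH]; first by rewrite /root_prod big_nil oner_eq0.
rewrite /root_prod big_cons mulf_eq0 -/(root_prod int w a) IH inE subr_eq0.
by rewrite eqr_nat.
Qed.

Lemma vdm_sq_ge0 w : 0 <= vdm_sq int w.
Proof. by elim: w => //= a w IH; rewrite mulr_ge0 // sqr_ge0. Qed.

Lemma vdm_sq_eq0 w : (vdm_sq int w == 0) = ~~ uniq w.
Proof.
elim: w => //= a w IH.
by rewrite mulf_eq0 IH expf_eq0 /= root_prod_eq0 negb_and negbK.
Qed.

Lemma root_prod_le A w a : (a < A)%N -> all (gtn A) w -> `|root_prod int w a| <= (A ^
  size w)%:R.
Proof.
move=> lta; elim: w => [|b w IH] /=; first by rewrite /root_prod big_nil.
move=> /andP[ltb /IH le]; rewrite /root_prod big_cons -/(root_prod int w a) normrM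
  expnS natrM.
apply: ler_pM => //; lia.
Qed.

Lemma vdm_sq_le A w : (0 < A)%N -> all (gtn A) w ->
  vdm_sq int w <= (A ^ (2 * (size w * size w)))%:R.
Proof.
move=> A0; elim: w => [|a w IH] //= /andP[lta hw].
apply: (@Order.POrderTheory.le_trans _ _ ((A ^ (2 * size w))%:R * (A ^ (2 * (size w *
  size w)))%:R)).
  apply: ler_pM; rewrite ?sqr_ge0 ?vdm_sq_ge0 ?IH //.
  rewrite -real_normK ?num_real // mulnC expnM natrX.
  by apply: lerXn2r; rewrite ?nnegrE // root_prod_le.
rewrite -natrM -expnD ler_nat leq_pexp2l //; lia.
Qed.

Variables (col : nat -> nat -> nat) (p kap : nat).

(** The last district offers at most [k] labels for each previous cut [i'], and (k + 1) (k + 2)^i'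
    summed over i' < i is the geometric sum (k + 2)^i - 1. *)
Lemma words_count k i j d : (kap <= k)%N ->
  (size (words col p kap i j d) <= k.+2 ^ i)%N.
Proof.
move=> lek; elim/ltn_ind: i j d => i IH j d.
case: (posnP i) => [->|i0]; first by rewrite words0 size_nseq; case: (_ && _).
rewrite wordsS // size_flatten /shape -map_comp sumnE big_map.
rewrite -[X in (_ <= X)%N]prednK ?expn_gt0 // predn_exp big_distrr /=.
apply: leqW; rewrite -{1}(subn0 i) big_mkord; apply: leq_sum => i' _.
rewrite /ext; case: ifP => _.
  case: j => // j; apply: leq_trans (IH i' (ltn_ord i') _ _) _.
  by rewrite leq_pmull.
case: d => // d; rewrite size_allpairs size_map size_iota leq_mul ?IH //; exact: leqW.
Qed.

Lemma mem_words_lt m i j d w a : (forall x y, (col x y < m)%N) ->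
  w \in words col p kap i j d -> a \in w -> (a < m * kap)%N.
Proof.
move=> hm /wordsP [cs [_ _ _ _ [h5 h6]]] aw.
have k0 : (0 < kap)%N by case/orP: h5 aw => // /eqP ->.
rewrite -ltn_divLR //.
have : (a %/ kap)%N \in [seq (b %/ kap)%N | b <- w] by apply: map_f.
rewrite h6 mem_rev mem_filter => /andP[_]; rewrite /colors.
elim: cs 0%N {h6} => //= c cs IH x; rewrite inE => /orP[/eqP ->|]; [exact: hm|exact: IH].
Qed.

(** A word without stars is the empty multiset T, so this is the plain sum of the V(w)^2. It is
    nonnegative; the absolute value only changes the type. *)
Definition total i j d : nat := `|walk_sum col p kap int i j (nseq d.+1 true)|%N.

Lemma walk_sum_bars i j d :
  walk_sum col p kap int i j (nseq d.+1 true) =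
  \sum_(w <- words col p kap i j d) vdm_sq int w.
Proof.
rewrite /walk_sum (_ : (bars (nseq d.+1 true)).-1 = d); last by rewrite bars_nseq.
by apply: eq_bigr => w _; rewrite star_prod_bars mulr1.
Qed.

(** All factors are integer polynomials in the labels and nodes. Hence a sum evaluated modulo some
    number is the residue of the integer sum, to which positivity applies. *)
Lemma walk_sum_int (R : comNzRingType) i j u :
  walk_sum col p kap R i j u = (walk_sum col p kap int i j u)%:~R.
Proof.
have hE w t : root_prod R w t = (root_prod int w t)%:~R.
  by rewrite /root_prod rmorph_prod; apply: eq_bigr => a _; rewrite rmorphB /= !rmorph_nat.
have hD w : vdm_sq R w = (vdm_sq int w)%:~R.
  by elim: w => [|a w IH] //=; rewrite IH hE rmorphM rmorphXn.
have hS w : star_prod R w u = (star_prod int w u)%:~R.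
  by elim: u => [|b u IH] //=; rewrite IH hE rmorphM /=; case: b.
rewrite /walk_sum rmorph_sum; apply: eq_bigr => w _.
by rewrite hD hS rmorphM.
Qed.

Lemma totalE i j d :
  (total i j d)%:Z = walk_sum col p kap int i j (nseq d.+1 true).
Proof.
by rewrite /total gez0_abs // walk_sum_bars sumr_ge0 // => w _; apply: vdm_sq_ge0.
Qed.

Lemma total_gt0 i j d :
  reflect (exists2 w, w \in words col p kap i j d & uniq w) (0 < total i j d)%N.
Proof.
rewrite lt0n -eqz_nat totalE walk_sum_bars psumr_eq0; last by move=> w _; apply: vdm_sq_ge0.
rewrite -has_predC; apply: (iffP hasP) => -[w hw uw]; exists w => //.
  by move: uw; rewrite /= vdm_sq_eq0 negbK.
by rewrite /= vdm_sq_eq0 negbK.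
Qed.

(** At most (k + 2)^i labellings contribute at most (m k)^(2 d^2) each, all labels being below m k.
    In powers of 2 the exponent is at most (i + 1) i + 2 (i + m) i^2. Twice the exponent of the
    statement is the largest modulus [tM]. *)
Lemma total_lt m k i j d : (forall x y, (col x y < m)%N) ->
  (kap <= k)%N -> (0 < k)%N -> (d <= k)%N -> (k <= i)%N ->
  (total i j d < 2 ^ (6 * (i + m) ^ 3))%N.
Proof.
move=> hm lek k0 ledk leki.
have m0 : (0 < m)%N by apply: leq_ltn_trans (hm 0%N 0%N).
have A0 : (0 < m * k)%N by rewrite muln_gt0 m0.
apply: (@leq_ltn_trans (k.+2 ^ i * (m * k) ^ (2 * (d * d)))).
  rewrite -(ler_nat int) [X in X <= _]natz totalE walk_sum_bars.
  apply: (@Order.POrderTheory.le_trans _ _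
    (\sum_(w <- words col p kap i j d) ((m * k) ^ (2 * (d * d)))%:R)).
    rewrite big_seq [X in _ <= X]big_seq; apply: ler_sum => w hw.
    rewrite -(size_words hw); apply: vdm_sq_le => //; apply/allP => a aw /=.
    by apply: leq_trans (mem_words_lt hm hw aw) _; rewrite leq_mul.
  rewrite big_const_seq count_predT iter_addr_0 -mulrnA ler_nat mulnC leq_mul //.
  exact: words_count.
apply: (@leq_ltn_trans (2 ^ (k.+1 * i + (m + k) * (2 * (d * d))))).
  rewrite expnD; apply: leq_mul.
    rewrite (expnM 2 k.+1).
    rewrite leq_exp2r; [exact: ltn_expl|exact: leq_trans k0 leki].
  have [->|d0] := posnP d; first by rewrite !muln0.
  have d2 : (0 < 2 * (d * d))%N by rewrite !muln_gt0 d0.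
  rewrite (expnM 2 (m + k)) (leq_exp2r _ _ d2) expnD.
  by apply: leq_mul; apply: ltnW; apply: ltn_expl.
rewrite ltn_exp2l //.
apply: (@leq_ltn_trans (i.+1 * i + (i + m) * (2 * (i * i)))).
  apply: leq_add; first by rewrite leq_mul.
  apply: leq_mul; first by lia.
  by rewrite leq_mul2l /= leq_mul // (leq_trans ledk leki).
rewrite !expnS expn0 muln1; nia.
Qed.

End Positive.

(** * Districts of a path *)

Section Path.
Variables (I : wgm_instance) (s : seq 'I_(nvoters I)).
Variable eta : {set 'I_(nvoters I)} -> 'I_(ncands I).
Hypotheses (us : uniq s) (sall : forall v, v \in s).
Hypothesis sE : forall u v, edge u v = (index v s == (index u s).+1)
                                    || (index u s == (index v s).+1).
Hypothesis n0 : 0 < nvoters I.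

Notation n := (nvoters I).
Definition idx (v : 'I_n) := index v s.

Lemma size_s : size s = n.
Proof.
have h : s =i enum 'I_n by move=> v; rewrite sall mem_enum.
by rewrite (perm_size (uniq_perm us (enum_uniq _) h)) size_enum_ord.
Qed.

Lemma idx_lt v : idx v < n.
Proof. by rewrite -size_s index_mem. Qed.

Lemma idx_inj : injective idx.
Proof. by move=> u v; apply: index_inj. Qed.

Lemma idx_surj x : x < n -> exists v, idx v = x.
Proof.
by move=> lt; exists (nth (Ordinal n0) s x); rewrite /idx index_uniq ?size_s.
Qed.

Definition interval x y := [set v | x <= idx v < y].

Lemma interval_district x y : x < y -> y <= n -> district (interval x y).
Proof.
move=> ltxy leyn; apply/andP; split.
  have [v hv] := idx_surj (leq_trans ltxy leyn).
  by apply/set0Pn; exists v; rewrite inE hv leqnn.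
have up d u v : u \in interval x y -> v \in interval x y -> idx v = idx u + d ->
    connect (induced_edge (interval x y)) u v.
  elim: d u => [|d IH] u hu hv e; first by rewrite (idx_inj (etrans e (addn0 _))).
  have [u' hu'] : exists u', idx u' = (idx u).+1.
    by apply: idx_surj; apply: leq_trans (idx_lt v); rewrite e; lia.
  have hu2 : u' \in interval x y by move: hu hv; rewrite !inE hu' e; lia.
  apply: (connect_trans (y := u')); last by apply: IH => //; rewrite e hu' addSnnS.
  apply: connect1; apply/and3P; split=> //.
  by rewrite sE -!/(idx _) hu' eqxx.
have sym : connect_sym (induced_edge (interval x y)).
  by apply: sym_connect_sym => u v; rewrite /induced_edge /= edge_sym andbCA.
apply/forall_inP => u hu; apply/forall_inP => v hv.
case: (leqP (idx u) (idx v)) => [le|/ltnW le].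
  by apply: (up (idx v - idx u)); rewrite ?subnKC.
by rewrite sym; apply: (up (idx u - idx v)); rewrite ?subnKC.
Qed.

(** Neighbours on the path differ by 1 in position. If some [x] between the first and the last
    member were missing, no edge inside [U] could jump over it, and the members before [x] would be
    cut off from [v]. *)
Lemma district_interval U v i : district U -> v \in U -> idx v = i ->
  (forall u, u \in U -> idx u <= i) -> exists2 l, l <= i & U = interval l i.+1.
Proof.
move=> /andP[_ /forall_inP hU] vU vi hle.
have [z zU zmin] := @arg_minnP _ v (mem U) idx vU.
exists (idx z); first exact: hle.
apply/setP => x; rewrite inE ltnS; case: (boolP (x \in U)) => [xU|xU].
  by rewrite (zmin x xU) hle.
apply/esym/negP => /andP[le1 le2].
have ne u : u \in U -> idx u != idx x.
  by move=> uU; apply: contraNneq xU => /idx_inj <-.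
have cl : closed (induced_edge U) [pred u | idx u < idx x].
  move=> a b /and3P[/ne aU /ne bU]; rewrite sE -!/(idx _) !inE.
  by move: (idx a) (idx b) (idx x) aU bU => A B X; lia.
have /forall_inP/(_ v vU) hc := hU z zU.
have := closed_connect cl hc; rewrite !inE vi.
by have := ne z zU; lia.
Qed.

Definition blocks cs := pairmap interval 0 cs.

Lemma blocks_rcons cs i : blocks (rcons cs i) = rcons (blocks cs) (interval (last 0 cs) i).
Proof. by rewrite /blocks -!cats1 pairmap_cat. Qed.

Lemma interval_cat l i : l <= i -> interval l i :|: interval 0 l = interval 0 i.
Proof. by move=> le; apply/setP => v; rewrite !inE; lia. Qed.

Lemma disjoint_interval l i : [disjoint interval l i & interval 0 l].
Proof.
rewrite -setI_eq0; apply/eqP/setP => v; rewrite !inE; lia.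
Qed.

Lemma blocks_partition cs : path ltn 0 cs -> last 0 cs <= n ->
  [/\ uniq (blocks cs), partition [set U in blocks cs] (interval 0 (last 0 cs))
    & all (@district I) (blocks cs)].
Proof.
elim/last_ind: cs => [|cs i IH].
  move=> _ _; split=> //=.
  have -> : interval 0 0 = set0 by apply/setP => v; rewrite !inE ltn0 andbF.
  by rewrite partition_set0; apply/eqP/setP => U; rewrite !inE.
rewrite rcons_path last_rcons blocks_rcons => /andP[h1 /= lti] lein.
have [u p d] := IH h1 (leq_trans (ltnW lti) lein).
have di := interval_district lti lein.
have ne : interval (last 0 cs) i != set0 by case/andP: di.
split; last by rewrite all_rcons di.
- rewrite rcons_uniq u andbT; apply/negP => hin.
  have : interval (last 0 cs) i \subset interval 0 (last 0 cs).
    by rewrite -(cover_partition p) (bigcup_max (interval (last 0 cs) i)) // inE.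
  have [v hv] := set0Pn _ ne; move/subsetP/(_ v hv); move: hv; rewrite !inE; lia.
- rewrite -(interval_cat (ltnW lti)).
  have -> : [set U in rcons (blocks cs) (interval (last 0 cs) i)] =
      interval (last 0 cs) i |: [set U in blocks cs].
    by apply/setP => U; rewrite !inE mem_rcons inE.
  exact: partitionU1 p ne (disjoint_interval _ _).
Qed.

(** The part that contains the last vertex is an interval; what it leaves is a shorter prefix of the
    path, to which induction applies. *)
Lemma partition_blocks i P : i <= n -> partition P (interval 0 i) ->
  (forall U, U \in P -> district U) ->
  exists cs, [/\ path ltn 0 cs, last 0 cs = i & P = [set U in blocks cs]].
Proof.
elim/ltn_ind: i P => -[|i] IH P lein hP dP.
  exists [::]; split=> //; apply/eqP; move: hP.
  have -> : interval 0 0 = set0 by apply/setP => v; rewrite !inE ltn0 andbF.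
  rewrite partition_set0 => /eqP ->; apply/eqP/setP => U; rewrite !inE //.
have [v hv] := idx_surj lein.
have vc : v \in cover P by rewrite (cover_partition hP) inE hv leqnn.
have UP := pblock_mem vc; have vU : v \in pblock P v by rewrite mem_pblock.
set U := pblock P v in UP vU.
have hle u : u \in U -> idx u <= i.
  move=> uU; have : u \in cover P by apply/bigcupP; exists U.
  by rewrite (cover_partition hP) inE ltnS.
have [l leli eU] := district_interval (dP U UP) vU hv hle.
have eD : interval 0 i.+1 :\: U = interval 0 l.
  by apply/setP => u; rewrite eU !inE; lia.
have hP' := partitionD1 hP UP; rewrite eD in hP'.
have [|||cs [h1 h2 h3]] := IH l _ _ _ hP'; first by lia.
- by lia.
- by move=> W; rewrite !inE => /andP[_ /dP].
exists (rcons cs i.+1); rewrite rcons_path last_rcons h1 h2 /= ltnS; split=> //.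
rewrite blocks_rcons h2 -eU; apply/setP => W; rewrite inE mem_rcons inE.
have : (W \in P :\ U) = (W \in [set U in blocks cs]) by rewrite h3.
by rewrite !inE; case: eqP => [->|_] //= ->.
Qed.

Definition icol x y : nat := eta (interval x y).

Lemma colors_blocks cs : colors icol cs = [seq nat_of_ord (eta U) | U <- blocks cs].
Proof. by rewrite /colors /blocks; elim: cs 0 => //= c cs IH x; rewrite IH. Qed.

Lemma card_blocks cs (Q : pred {set 'I_n}) : uniq (blocks cs) ->
  #|[set U in [set U in blocks cs] | Q U]| = count Q (blocks cs).
Proof.
move=> u; rewrite -size_filter -(card_uniqP (filter_uniq Q u)).
by apply: eq_card => U; rewrite !inE mem_filter andbC.
Qed.

Lemma wins_blocks cs q : uniq (blocks cs) ->
  wins eta [set U in blocks cs] q = count_mem (nat_of_ord q) (colors icol cs).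
Proof.
move=> u; rewrite /wins card_blocks // colors_blocks count_map.
by apply: eq_count => U.
Qed.

Lemma size_others p q : size q = count_mem p q + size (others p q).
Proof. by rewrite size_filter -(count_predC (pred1 p)). Qed.

Notation p := (nat_of_ord (pref I)).

Lemma wgm_yesP : wgm_yes eta <->
  exists h, 0 < h <= ndist I /\
  exists cs, [/\ path ltn 0 cs, last 0 cs = n, count_mem p (colors icol cs) = h,
    size (others p (colors icol cs)) = ndist I - h &
    forall q, q != p -> count_mem q (colors icol cs) <= h.-1].
Proof.
have iT : interval 0 n = setT by apply/setP => v; rewrite !inE idx_lt.
split=> [/existsP[P /and4P[hP /eqP cP /forall_inP dP /forallP wP]]|[h [/andP[h0 hk]
  [cs [h1 h2 h3 h4 h5]]]]].
- rewrite -iT in hP; have [cs [h1 h2 h3]] := partition_blocks (leqnn n) hP dP.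
  have [u _ _] : [/\ uniq (blocks cs), partition [set U in blocks cs] (interval 0
    (last 0 cs))
    & all (@district I) (blocks cs)] by apply: blocks_partition => //; rewrite h2.
  have sz : size (colors icol cs) = ndist I.
    by rewrite -cP h3 cardsE (card_uniqP u) colors_blocks size_map.
  have sz2 := size_others p (colors icol cs); rewrite sz in sz2.
  have hq (q : 'I_(ncands I)) : nat_of_ord q != p ->
      count_mem (nat_of_ord q) (colors icol cs) < count_mem p (colors icol cs).
    by move=> qp; have := wP q; rewrite h3 !wins_blocks // => /implyP; apply.
  exists (count_mem p (colors icol cs)); split; last exists cs.
    apply/andP; split; last by rewrite sz2 leq_addr.
    (* Some district exists. Its winner is [p] or a candidate that [p] has to beat; in both cases
       [p] wins a district. *)
    have := ndist_gt0 I; rewrite -sz colors_blocks.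
    case E : (blocks cs) => [|U bl] //= _; case: eqP => //= ne.
    have := hq (eta U); rewrite colors_blocks E /= eqxx; move/eqP: ne => ne; move/(_ ne).
    by rewrite (negPf ne); lia.
  split=> //; first by rewrite sz2 addKn.
  (* Colors are plain numbers here; a number that is no candidate does not occur among them. *)
  move=> q qp; case: (ltnP q (ncands I)) => [ltq|leq].
    by have := hq (Ordinal ltq) qp; rewrite /=; lia.
  rewrite (count_memPn _) //; apply/negP; rewrite colors_blocks => /mapP[U _ e].
  by move: leq; rewrite e leqNgt ltn_ord.
- have [u hP dP] : [/\ uniq (blocks cs), partition [set U in blocks cs] (interval 0
    (last 0 cs))
    & all (@district I) (blocks cs)] by apply: blocks_partition => //; rewrite h2.
  apply/existsP; exists [set U in blocks cs]; apply/and4P; split.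
  + by rewrite -iT; rewrite h2 in hP.
  + rewrite cardsE (card_uniqP u) -(size_map (fun U => nat_of_ord (eta U))).
    by rewrite -colors_blocks (size_others p) h3 h4 subnKC.
  + by apply/forall_inP => U; rewrite inE => /(allP dP).
  + apply/forallP => q; apply/implyP => qp; rewrite !wins_blocks // h3.
    by apply: leq_ltn_trans (h5 _ qp) _; rewrite prednK.
Qed.

End Path.

(** * Compiling table computations *)

Local Notation smem := Defs.mem.

(* A bound variable is a number: the value of the variable when the term is
   evaluated by [den], the register that holds it when the term is compiled by
   [compile]. [Get] returns 0 beyond the end of a table. *)
Inductive term :=
  | Var of nat
  | Cst of nat
  | Op of binop & term & term
  | Rem of term & term
  | Ite of term & term & term
  | Sum of term & (nat -> term)
  | Let of term & (nat -> term)
  | Get of nat & term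
  | Ask of nat & term.

Definition ntabs := 10.

Definition fib_table := 4.

(* Registers [2 * q] and [2 * q + 1] hold the address and the current length of
   table [q], [regn] the number of voters and [regf] the first free address;
   registers from [reg0] on are scratch. *)
Definition regn := 2 * ntabs.
Definition regf := regn.+1.
Definition reg0 := regf.+1.

Section Den.
Variables (nv : nat) (orc : (nat -> nat) -> nat).

(** In [Rem] the divisor is one more than the second argument: it is never 0, and the second
    argument bounds the result. [Ask] returns 0 when its [nv] cells run past the end of the table,
    so the oracle depends on table entries only. *)
Fixpoint den (tabs : seq (seq nat)) (t : term) : nat :=
  match t with
  | Var v => v
  | Cst z => z
  | Op o a b => binop_fun o (den tabs a) (den tabs b)
  | Rem a b => den tabs a %% (den tabs b).+1
  | Ite c a b => if den tabs c != 0 then den tabs a else den tabs b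
  | Sum a f => \sum_(i < den tabs a) den tabs (f i)
  | Let a f => den tabs (f (den tabs a))
  | Get q a => nth 0 (nth [::] tabs q) (den tabs a)
  | Ask q a =>
      if size (nth [::] tabs q) < den tabs a + nv then 0
      else orc (fun i => nth 0 (nth [::] tabs q) (den tabs a + i))
  end.

(** An entry may refer to its own table: the part already filled is appended to [tabs], so [Get]
    with the number of the new table reads earlier entries. *)
Definition fill tabs N (f : nat -> term) : seq nat :=
  iter N (fun s => rcons s (den (rcons tabs s) (f (size s)))) [::].

Lemma size_fill tabs N f : size (fill tabs N f) = N.
Proof. by elim: N => //= N IH; rewrite size_rcons IH. Qed.

Lemma nth_fill_prefix tabs x N f j :
  j < x -> x <= N -> nth 0 (fill tabs x f) j = nth 0 (fill tabs N f) j.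
Proof.
move=> ltjx; elim: N => [|N IH]; first by rewrite leqn0 => /eqP ->.
rewrite leq_eqVlt => /orP[/eqP -> //|]; rewrite ltnS => lexN.
by rewrite /= nth_rcons size_fill (leq_trans ltjx lexN) IH.
Qed.

Lemma nth_fill tabs N f x : x < N ->
  nth 0 (fill tabs N f) x = den (rcons tabs (fill tabs x f)) (f x).
Proof.
move=> ltxN; rewrite -(@nth_fill_prefix tabs x.+1) //=.
by rewrite nth_rcons size_fill ltnn eqxx.
Qed.

Fixpoint fills tabs (ps : seq (term * (nat -> term))) : seq (seq nat) :=
  if ps is (N, f) :: ps' then fills (rcons tabs (fill tabs (den tabs N) f)) ps'
  else tabs.

End Den.

(** The result goes to register [r], lower registers are preserved, higher ones are scratch. The
    bound variable is the loop counter [r.+1] in [Sum] and the register [r] itself in [Let]. *)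
Fixpoint compile (t : term) (r : nat) : cmd :=
  match t with
  | Var v => Set_ r (Reg v)
  | Cst z => Set_ r (Const z)
  | Op o a b =>
      Seq (compile a r) (Seq (compile b r.+1) (Set_ r (Bin o (Reg r) (Reg r.+1))))
  | Rem a b =>
      Seq (compile a r) (Seq (compile b r.+1)
        (Set_ r (Bin Mod (Reg r) (Bin Add (Reg r.+1) (Const 1)))))
  | Ite c a b => Seq (compile c r) (If (Reg r) (compile a r) (compile b r))
  | Sum a f =>
      Seq (compile a r.+2) (Seq (Set_ r (Const 0)) (Seq (Set_ r.+1 (Const 0))
        (While (Bin Lt (Reg r.+1) (Reg r.+2))
          (Seq (compile (f r.+1) r.+3)
          (Seq (Set_ r (Bin Add (Reg r) (Reg r.+3)))
               (Set_ r.+1 (Bin Add (Reg r.+1) (Const 1))))))))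
  | Let a f => Seq (compile a r) (Seq (compile (f r) r.+1) (Set_ r (Reg r.+1)))
  | Get q a =>
      Seq (compile a r) (If (Bin Lt (Reg r) (Reg (2 * q).+1))
        (Set_ r (Fetch (Bin Add (Reg (2 * q)) (Reg r)))) (Set_ r (Const 0)))
  | Ask q a =>
      Seq (compile a r) (If (Bin Lt (Reg (2 * q).+1) (Bin Add (Reg r) (Reg regn)))
        (Set_ r (Const 0)) (Query r (Bin Add (Reg (2 * q)) (Reg r))))
  end.

(** Register [2 * q + 1] is at once loop counter, bound variable of the entry and current length of
    the table. The bounds test of [Get] therefore sees exactly the part filled so far, as in
    [fill]. *)
Definition phase q (p : term * (nat -> term)) : cmd :=
  Seq (compile p.1 reg0) (Seq (Set_ (2 * q) (Reg regf))
    (Seq (While (Bin Lt (Reg (2 * q).+1) (Reg reg0))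
      (Seq (compile (p.2 (2 * q).+1) reg0.+1)
      (Seq (Store (Bin Add (Reg (2 * q)) (Reg (2 * q).+1)) (Reg reg0.+1))
           (Set_ (2 * q).+1 (Bin Add (Reg (2 * q).+1) (Const 1))))))
    (Set_ regf (Bin Add (Reg regf) (Reg (2 * q).+1))))).

Fixpoint phases q ps (c : cmd) : cmd :=
  if ps is p :: ps' then Seq (phase q p) (phases q.+1 ps' c) else c.

(* A value of class [(b, e)] is at most [B ^ e], times [U] if [b] holds; below [B] is
   the number of voters and candidates and [U] is [fib (2 * k + 4)]. In
   [bounded_term G t t' c e] the term [t] is to be evaluated and [t'] to be compiled; [B ^ e] bounds the running
   time and [U * B ^ e] all intermediate values. *)
Definition cost_class := (bool * nat)%type.

(** A product of two quantities that may each contain U is rejected, and [OkSum] below admits only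
    ranges without U. This keeps U^2 out of all values and U out of the time for a single entry. *)
Definition binop_class (o : binop) (a b : cost_class) : option cost_class :=
  match o with
  | Add => Some (a.1 || b.1, (maxn a.2 b.2).+1)
  | Defs.Sub | Div => Some a
  | Mul => if a.1 && b.1 then None else Some (a.1 || b.1, a.2 + b.2)
  | Mod => None
  | Lt | Eq => Some (false, 0)
  end.

(** * Absence of overflow and running time of compiled terms *)

Section Bounds.
Variable tc : seq cost_class.

Inductive bounded_term : seq (nat * nat * cost_class) -> term -> term -> cost_class
  -> nat -> Prop :=
  | OkVar G v r c :
      List.In (v, r, c) G -> bounded_term G (Var v) (Var r) c (c.2 + 2)
  | OkCst G z : bounded_term G (Cst z) (Cst z) (false, z) (z + 2)
  | OkOp G o a a' b b' ca cb c ta tb :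
      bounded_term G a a' ca ta -> bounded_term G b b' cb tb -> binop_class o ca cb =
        Some c ->
      bounded_term G (Op o a b) (Op o a' b') c (ta + tb + c.2 + 3)
  | OkRem G a a' b b' ca cb ta tb :
      bounded_term G a a' ca ta -> bounded_term G b b' cb tb ->
      bounded_term G (Rem a b) (Rem a' b') cb (ta + tb + cb.2 + 3)
  | OkIte G z z' a a' b b' cz ca cb c tz ta tb :
      bounded_term G z z' cz tz -> bounded_term G a a' ca ta -> bounded_term G b b' cb tb ->
      (ca.1 || cb.1, maxn ca.2 cb.2) = c ->
      bounded_term G (Ite z a b) (Ite z' a' b') c (tz + ta + tb + c.2 + 3)
  | OkSum G a a' f f' ca cf c ta tf :
      bounded_term G a a' ca ta -> ca.1 = false ->
      (forall v r, bounded_term ((v, r, ca) :: G) (f v) (f' r) cf tf) ->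
      (cf.1, ca.2 + cf.2) = c ->
      bounded_term G (Sum a f) (Sum a' f') c (ta + tf + c.2 + 5)
  | OkLet G a a' f f' ca cf ta tf :
      bounded_term G a a' ca ta ->
      (forall v r, bounded_term ((v, r, ca) :: G) (f v) (f' r) cf tf) ->
      bounded_term G (Let a f) (Let a' f') cf (ta + tf + cf.2 + 3)
  | OkGet G q a a' ca c ta :
      q < ntabs -> bounded_term G a a' ca ta -> nth (false, 0) tc q = c ->
      bounded_term G (Get q a) (Get q a') c (ta + c.2 + 4)
  | OkAsk G q a a' ca ta :
      q < ntabs -> bounded_term G a a' ca ta ->
      bounded_term G (Ask q a) (Ask q a') (false, 1) (ta + ca.2 + 5).

Variables (w : nat) (orc : (nat -> nat) -> nat) (nv B U : nat).
Hypothesis B2 : 2 <= B.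
Hypothesis U0 : 0 < U.
Hypothesis nvB : nv <= B.
Hypothesis orcB : forall f, orc f <= B.
Hypothesis orcE : forall f g, (forall i, i < nv -> f i = g i) -> orc f = orc g.

Definition class_bound (c : cost_class) := (if c.1 then U else 1) * B ^ c.2.

Lemma B0 : 0 < B. Proof. exact: ltnW. Qed.

Lemma class_bound_le c t : c.2 <= t -> class_bound c <= U * B ^ t.
Proof.
by move=> le; rewrite /class_bound leq_mul ?leq_pexp2l ?B0 //; case: ifP.
Qed.

Lemma class_bound_mono (c c' : cost_class) : c.1 ==> c'.1 -> c.2 <= c'.2 ->
  class_bound c <= class_bound c'.
Proof.
case: c c' => [a e] [a' e'] /= ha he.
by rewrite /class_bound /= leq_mul ?leq_pexp2l ?B0 //; case: a a' ha => [] [].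
Qed.

Lemma class_bound_double c : class_bound c + class_bound c <= class_bound (c.1, c.2.+1).
Proof. by rewrite /class_bound /= addnn -mul2n expnS mulnCA !leq_mul. Qed.

Lemma binop_class_bound o ca cb c x y : binop_class o ca cb = Some c ->
  x <= class_bound ca -> y <= class_bound cb -> binop_fun o x y <= class_bound c.
Proof.
case: o => //=.
- case=> <- hx hy; have hM := class_bound_double (ca.1 || cb.1, maxn ca.2 cb.2).
  apply: leq_trans hM; apply: leq_add.
  + by apply: (leq_trans hx); apply: class_bound_mono; [case: ca.1|exact: leq_maxl].
  + apply: (leq_trans hy); apply: class_bound_mono; last exact: leq_maxr.
    by case: ca.1; case: cb.1.
- by case=> <- hx hy; apply: leq_trans hx; apply: leq_subr.
- case: ifP => // h [<-] hx hy; apply: (leq_trans (leq_mul hx hy)).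
  rewrite /class_bound /= expnD.
  by case: ca.1 h; case: cb.1 => //= _; rewrite ?mul1n -?mulnA // mulnCA.
- by case=> <- hx hy; apply: leq_trans hx; apply: leq_div.
- by case=> <- _ _; rewrite /class_bound /=; case: (_ < _).
- by case=> <- _ _; rewrite /class_bound /=; case: (_ == _).
Qed.

Definition tables_le (tabs : seq (seq nat)) :=
  forall q i, nth 0 (nth [::] tabs q) i <= class_bound (nth (false, 0) tc q).

Definition tables_stored tabs (s : state) :=
  regs s regn = nv /\
  forall q, q < ntabs ->
  [/\ regs s (2 * q).+1 = size (nth [::] tabs q),
      regs s (2 * q) + size (nth [::] tabs q) < 2 ^ w &
      forall i, i < size (nth [::] tabs q) ->
        smem s (regs s (2 * q) + i) = nth 0 (nth [::] tabs q) i].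

Lemma tables_stored_frame tabs s s' : tables_stored tabs s -> smem s' = smem s ->
  (forall i, i < regf -> regs s' i = regs s i) -> tables_stored tabs s'.
Proof.
move=> [hn hq] hm hr; split; first by rewrite hr.
move=> q ltq; have [h1 h2 h3] := hq q ltq.
have r1 : (2 * q).+1 < regf by rewrite /regf /regn; lia.
by rewrite !hr ?hm //; apply: ltn_trans r1.
Qed.

Lemma upd_same f i x : upd f i x i = x.
Proof. by rewrite /upd eqxx. Qed.

Lemma upd_other f i x j : j != i -> upd f i x j = f j.
Proof. by rewrite /upd => /negPf ->. Qed.

Definition env_stored (G : seq (nat * nat * cost_class)) (s : state) (r : nat) :=
  forall v q c, List.In (v, q, c) G -> [/\ regs s q = v, q < r & v <= class_bound c].

Lemma env_storedW G s s' r r' : r <= r' -> (forall q, q < r -> regs s' q = regs s q) ->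
  env_stored G s r -> env_stored G s' r'.
Proof.
move=> le hr hG v q c /hG [h1 h2 h3]; split=> //; first by rewrite hr.
exact: leq_trans le.
Qed.

Definition result r s s' x :=
  [/\ regs s' r = x, forall q, q < r -> regs s' q = regs s q & smem s' = smem s].

Lemma bounded_term_class G t t' c e : bounded_term G t t' c e -> c.2 <= e.
Proof. by elim=> *; rewrite /=; lia. Qed.

Lemma pow_gt0 e : 0 < B ^ e. Proof. by rewrite expn_gt0 B0. Qed.

Lemma pow_le e e' : e <= e' -> B ^ e <= B ^ e'.
Proof. by move=> le; rewrite leq_pexp2l ?B0. Qed.

Lemma pow2_le e : 2 ^ e <= B ^ e.
Proof. by case: e => // e; rewrite leq_exp2r. Qed.

(** The constants added to the exponents in [bounded_term] pay for bookkeeping instructions: since B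
    >= 2, a surplus of 3 in the exponent is worth a factor 8. *)
Lemma pow3 a b e z : z <= 6 -> B ^ a + B ^ b + z <= B ^ (a + b + e + 3).
Proof.
move=> hz; apply: (@leq_trans (B ^ (a + b) * 2 ^ 3)).
  by rewrite expnD; move: (pow_gt0 a) (pow_gt0 b); nia.
rewrite -(addnA (a + b)) (expnD _ (a + b) (e + 3)) leq_mul2l; apply/orP; right.
by apply: leq_trans (pow2_le 3) _; apply: pow_le; lia.
Qed.

Lemma pow0 e z : z <= 4 -> z <= B ^ (e + 2).
Proof.
move=> hz; apply: leq_trans (leq_trans (pow2_le 2) (pow_le _)); last exact: leq_addl.
exact: hz.
Qed.

Lemma pow1 a e z : z <= 15 -> B ^ a + z <= B ^ (a + e + 4).
Proof.
move=> hz; apply: (@leq_trans (B ^ a * 2 ^ 4)); first by move: (pow_gt0 a); nia.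
rewrite -addnA (expnD _ a) leq_mul2l; apply/orP; right.
by apply: leq_trans (pow2_le 4) _; apply: pow_le; lia.
Qed.

Lemma den_le tabs G t t' c e : tables_le tabs -> bounded_term G t t' c e ->
  (forall v q c', List.In (v, q, c') G -> v <= class_bound c') -> den nv orc tabs t
    <= class_bound c.
Proof.
move=> htab; elim=> {G t t' c e} /=.
- by move=> G v r c hin hG; apply: hG hin.
- by move=> G z _; rewrite /class_bound /= mul1n ltnW // ltn_expl.
- move=> G o a a' b b' ca cb c ta tb _ IHa _ IHb ho hG.
  by apply: binop_class_bound ho _ _; [apply: IHa|apply: IHb].
- move=> G a a' b b' ca cb ta tb _ _ _ IHb hG.
  by apply: leq_trans (IHb hG); rewrite -ltnS ltn_mod.
- move=> G z z' a a' b b' cz ca cb c tz ta tb _ _ _ IHa _ IHb <- hG.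
  case: ifP => _.
    by apply: (leq_trans (IHa hG)); apply: class_bound_mono; [case: ca.1|exact: leq_maxl].
  apply: (leq_trans (IHb hG)); apply: class_bound_mono; last exact: leq_maxr.
  by case: ca.1; case: cb.1.
- move=> G a a' f f' [[] i] cf c ta tf _ IHa //= _ _ IHf <- hG.
  apply: (@leq_trans (B ^ i * class_bound cf)); last first.
    by rewrite /class_bound /= expnD mulnCA.
  have ha : den nv orc tabs a <= B ^ i.
    by apply: leq_trans (IHa hG) _; rewrite /class_bound /= mul1n.
  apply: (@leq_trans (\sum_(j < den nv orc tabs a) class_bound cf)).
    apply: leq_sum => j _; apply: (IHf j 0) => v q c' /= [[<- _ <-]|]; last exact: hG.
    by rewrite /class_bound /= mul1n; apply: leq_trans ha; apply: ltnW.
  by rewrite sum_nat_const card_ord leq_mul2r ha orbT.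
- move=> G a a' f f' ca cf ta tf _ IHa _ IHf hG.
  by apply: (IHf _ 0) => v q c' /= [[<- _ <-]|]; [exact: IHa|exact: hG].
- by move=> G q a a' ca c ta _ _ _ <- _; apply: htab.
- by move=> G q a a' ca ta _ _ _ _; case: ifP => // _; rewrite /class_bound /= mul1n expn1.
Qed.

Definition runs c s T (P : state -> Prop) :=
  exists t s', [/\ exec w orc c s t s', t <= T & P s'].

Lemma runs_weak c s T T' (P P' : state -> Prop) :
  runs c s T P -> T <= T' -> (forall s', P s' -> P' s') -> runs c s T' P'.
Proof.
move=> [t [s' [h1 h2 h3]]] le imp; exists t, s'; split=> //; last exact: imp.
exact: leq_trans le.
Qed.

Lemma runs_le c s T T' (P : state -> Prop) :
  runs c s T P -> T <= T' -> runs c s T' P.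
Proof. by move=> h le; apply: runs_weak h le _. Qed.

Lemma runs_seq c1 c2 s T1 T2 (P Q : state -> Prop) :
  runs c1 s T1 P -> (forall s1, P s1 -> runs c2 s1 T2 Q) ->
  runs (Seq c1 c2) s (T1 + T2) Q.
Proof.
move=> [t1 [s1 [h1 l1 p1]]] /(_ s1 p1) [t2 [s2 [h2 l2 p2]]].
exists (t1 + t2), s2; split=> //; first exact: ExecSeq h1 h2.
exact: leq_add.
Qed.

Lemma runs_set r a s (P : state -> Prop) :
  P (State (upd (regs s) r (eval w s a)) (smem s)) ->
  runs (Set_ r a) s (esize a).+1 P.
Proof. by move=> h; eexists _, _; split; [apply: ExecSet| |]. Qed.

Lemma runs_seteq r a s :
  runs (Set_ r a) s (esize a).+1
    (fun s' => s' = State (upd (regs s) r (eval w s a)) (smem s)).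
Proof. exact: runs_set. Qed.

Lemma runs_store a b s (P : state -> Prop) :
  P (State (regs s) (upd (smem s) (eval w s a) (eval w s b))) ->
  runs (Store a b) s (esize a + esize b).+1 P.
Proof. by move=> h; eexists _, _; split; [apply: ExecStore| |]. Qed.

Lemma runs_query r a s (P : state -> Prop) :
  P (State (upd (regs s) r (orc (fun i => smem s (eval w s a + i)))) (smem s)) ->
  runs (Query r a) s (esize a).+1 P.
Proof. by move=> h; eexists _, _; split; [apply: ExecQuery| |]. Qed.

Lemma runs_if a c1 c2 s T (P : state -> Prop) :
  runs (if eval w s a != 0 then c1 else c2) s T P ->
  runs (If a c1 c2) s ((esize a).+1 + T) P.
Proof.
move=> [t [s' [h1 h2 h3]]]; exists ((esize a).+1 + t), s'; split=> //.
  exact: ExecIf.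
by rewrite leq_add2l.
Qed.

Lemma runs_while a c N Tb (J : nat -> state -> Prop) :
  (forall i s, i < N -> J i s -> eval w s a != 0 /\ runs c s Tb (J i.+1)) ->
  (forall s, J N s -> eval w s a = 0) ->
  forall s, J 0 s ->
  runs (While a c) s (N * ((esize a).+1 + Tb) + (esize a).+1) (J N).
Proof.
move=> hstep hend.
suff H d s : d <= N -> J (N - d) s ->
    runs (While a c) s (d * ((esize a).+1 + Tb) + (esize a).+1) (J N).
  by move=> s hs; apply: H; rewrite ?subnn.
elim: d s => [|d IH] s led hs.
  rewrite subn0 in hs; eexists _, s; split; [apply: ExecWhileFalse| |] => //.
  exact: hend.
have [ha [t1 [s1 [h1 l1 p1]]]] := hstep (N - d.+1) s ltac:(lia) hs.
have [||t2 [s2 [h2 l2 p2]]] := IH s1; first exact: ltnW.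
  by move: p1; rewrite subnSK.
exists ((esize a).+1 + t1 + t2), s2; split=> //; first exact: ExecWhileTrue h1 h2.
rewrite mulSn; lia.
Qed.

Lemma tables_stored_result tabs s s' r x : reg0 <= r -> tables_stored tabs s ->
  result r s s' x -> tables_stored tabs s'.
Proof.
move=> le hi [_ h2 h3]; apply: tables_stored_frame hi h3 _ => i lti; apply: h2.
exact: leq_trans (leqW lti) le.
Qed.

Ltac upds := repeat (rewrite upd_same || (rewrite upd_other; last by lia)).

(** The exponent [e] dominates those of all subterms. Hence the single inequality
    [U * B ^ e < 2 ^ w] keeps every intermediate result from wrapping around, and word arithmetic
    agrees with [den]. *)
Lemma compile_runs tabs G t t' c e : tables_le tabs -> bounded_term G t t' c e ->
  U * B ^ e < 2 ^ w ->
  forall s r, reg0 <= r -> tables_stored tabs s -> env_stored G s r ->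
  runs (compile t' r) s (B ^ e) (fun s' => result r s s' (den nv orc tabs t)).
Proof.
move=> htab hok; elim: hok => {G t t' c e}.
- move=> G v r0 c hin hw s r le hi hG.
  have [h1 h2 h3] := hG _ _ _ hin.
  apply: runs_le (runs_set _) _.
    by split=> //=; upds => // q ltq; upds.
  exact: pow0.
- move=> G z hw s r le hi hG; apply: runs_le (runs_set _) _.
    split=> //=; upds; last by move=> q ltq; upds.
    rewrite modn_small //; apply: leq_trans hw; rewrite ltnS.
    apply: leq_trans (class_bound_le (c := (false, z)) (t := z + 2) _); last by
      rewrite /=; lia.
    by rewrite /class_bound /= mul1n ltnW // ltn_expl.
  exact: pow0.
- move=> G o a a' b b' ca cb c ta tb oka IHa okb IHb ho hw s r le hi hG.
  have wa : U * B ^ ta < 2 ^ w by apply: leq_ltn_trans hw; rewrite leq_mul ?pow_le; lia.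
  have wb : U * B ^ tb < 2 ^ w by apply: leq_ltn_trans hw; rewrite leq_mul ?pow_le; lia.
  apply: runs_le.
    apply: (runs_seq (IHa wa s r le hi hG)) => s1 r1.
    have hi1 := tables_stored_result le hi r1; have [x1 f1 m1] := r1.
    have hG1 : env_stored G s1 r.+1 by apply: env_storedW hG => //.
    apply: (runs_seq (IHb wb s1 r.+1 _ hi1 hG1)); first by lia.
    move=> s2 [x2 f2 m2]; apply: runs_set.
    split=> /=; [upds|by move=> q ltq; upds; rewrite f2 ?f1 //; lia|by rewrite m2].
    rewrite x2 f2 // x1 modn_small //; apply: leq_ltn_trans hw.
    have hv v q c' : List.In (v, q, c') G -> v <= class_bound c' by case/hG.
    apply: leq_trans (binop_class_bound ho (den_le htab oka hv) (den_le htab okb hv)) _.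
    by apply: class_bound_le; lia.
  by rewrite /= addnA; apply: pow3.
- move=> G a a' b b' ca cb ta tb oka IHa okb IHb hw s r le hi hG.
  have wa : U * B ^ ta < 2 ^ w by apply: leq_ltn_trans hw; rewrite leq_mul ?pow_le; lia.
  have wb : U * B ^ tb < 2 ^ w by apply: leq_ltn_trans hw; rewrite leq_mul ?pow_le; lia.
  apply: runs_le.
    apply: (runs_seq (IHa wa s r le hi hG)) => s1 r1.
    have hi1 := tables_stored_result le hi r1; have [x1 f1 m1] := r1.
    have hG1 : env_stored G s1 r.+1 by apply: env_storedW hG => //.
    apply: (runs_seq (IHb wb s1 r.+1 _ hi1 hG1)); first by lia.
    move=> s2 [x2 f2 m2]; apply: runs_set.
    split=> /=; [upds|by move=> q ltq; upds; rewrite f2 ?f1 //; lia|by rewrite m2].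
    have hv v q c' : List.In (v, q, c') G -> v <= class_bound c' by case/hG.
    have hb := den_le htab okb hv.
    have hb1 : (den nv orc tabs b).+1 < 2 ^ w.
      apply: leq_ltn_trans hw; apply: leq_trans (class_bound_le (c := (cb.1, cb.2.+1)) _).
        by apply: leq_trans (class_bound_double cb); rewrite -addn1 leq_add //
          /class_bound muln_gt0 pow_gt0 andbT; case: ifP.
      by rewrite /=; lia.
    have w1 : 1 < 2 ^ w by apply: leq_ltn_trans hb1.
    rewrite x2 f2 // x1 (modn_small w1) addn1 (modn_small hb1) modn_small //.
    by apply: ltn_trans hb1; rewrite ltn_mod.
  by rewrite /= addnA; apply: pow3.
- move=> G z z' a a' b b' cz ca cb c tz ta tb okz IHz oka IHa okb IHb _ hw s r le hi hG.
  have wz : U * B ^ tz < 2 ^ w by apply: leq_ltn_trans hw; rewrite leq_mul ?pow_le; lia.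
  have wa : U * B ^ ta < 2 ^ w by apply: leq_ltn_trans hw; rewrite leq_mul ?pow_le; lia.
  have wb : U * B ^ tb < 2 ^ w by apply: leq_ltn_trans hw; rewrite leq_mul ?pow_le; lia.
  apply: (runs_le (T := B ^ tz + (2 + B ^ (ta + tb)))).
    apply: (runs_seq (IHz wz s r le hi hG)) => s1 r1.
    have hi1 := tables_stored_result le hi r1; have [x1 f1 m1] := r1.
    have hG1 : env_stored G s1 r by apply: env_storedW hG.
    apply: (runs_if (a := Reg r)); rewrite /= x1; case: ifP => _.
      apply: runs_weak (IHa wa s1 r le hi1 hG1) _ _; first by apply: pow_le; lia.
      by move=> s2 [x2 f2 m2]; split; rewrite ?m2 // => q ltq; rewrite f2 ?f1.
    apply: runs_weak (IHb wb s1 r le hi1 hG1) _ _; first by apply: pow_le; lia.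
    by move=> s2 [x2 f2 m2]; split; rewrite ?m2 // => q ltq; rewrite f2 ?f1.
  have := @pow3 tz (ta + tb) c.2 2 isT.
  by rewrite !addnA; apply: leq_trans; rewrite addnAC leqnn.
- move=> G a a' f f' [[] i] cf c ta tf oka IHa //= _ okf IHf <- /= hw s r le hi hG.
  have wa : U * B ^ ta < 2 ^ w by apply: leq_ltn_trans hw; rewrite leq_mul ?pow_le; lia.
  have wf : U * B ^ tf < 2 ^ w by apply: leq_ltn_trans hw; rewrite leq_mul ?pow_le; lia.
  have hv v q c' : List.In (v, q, c') G -> v <= class_bound c' by case/hG.
  have hN : den nv orc tabs a <= B ^ i.
    by have := den_le htab oka hv; rewrite /class_bound /= mul1n.
  set N := den nv orc tabs a in hN *.
  have w2 : B ^ (i + 2) < 2 ^ w.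
    by apply: leq_ltn_trans hw; apply: leq_trans (leq_pmull _ U0); apply: pow_le; lia.
  have w1 : 1 < 2 ^ w by apply: leq_ltn_trans w2; apply: pow0.
  have wN : N < 2 ^ w.
    by apply: leq_ltn_trans w2; apply: leq_trans hN _; apply: pow_le; lia.
  have hsum j : j <= N -> \sum_(x < j) den nv orc tabs (f x) < 2 ^ w.
    move=> lej; apply: leq_ltn_trans hw.
    apply: leq_trans (class_bound_le (c := (cf.1, i + cf.2)) _); last by rewrite /=; lia.
    apply: (@leq_trans (B ^ i * class_bound cf)); last by rewrite /class_bound /=
      expnD mulnCA.
    apply: (@leq_trans (\sum_(x < j) class_bound cf)).
      apply: leq_sum => x _; apply: (den_le htab (okf x 0)) => v q c' /= [[<- _
        <-]|]; last exact: hv.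
      rewrite /class_bound /= mul1n; apply: leq_trans hN; apply: ltnW.
      exact: leq_trans (ltn_ord x) lej.
    rewrite sum_nat_const card_ord leq_mul2r; apply/orP; right.
    exact: leq_trans lej hN.
  apply: (runs_le (T := B ^ ta + (2 + (2 + (N * (4 + (B ^ tf + (4 + 4))) + 4))))).
  + have hG2 : env_stored G s r.+2 by apply: env_storedW hG => //; lia.
    apply: (runs_seq (IHa wa s r.+2 _ hi hG2)); first by lia.
    move=> s1 r1; have [x1 f1 m1] := r1.
    have hi1 : tables_stored tabs s1 by apply: tables_stored_result hi r1; lia.
    apply: runs_seq (runs_seteq _ _ _) _.
    move=> s2 ->; apply: runs_seq (runs_seteq _ _ _) _.
    move=> s3 ->.
    pose J j (s' : state) := [/\ regs s' r = \sum_(x < j) den nv orc tabs (f x),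
      regs s' r.+1 = j, regs s' r.+2 = N,
      forall q, q < r -> regs s' q = regs s q & smem s' = smem s].
    apply: runs_weak (runs_while (N := N) (Tb := B ^ tf + (4 + 4)) (J := J) _ _ _) _
      _; last 1 first.
    * by move=> s' [h1 h2 h3 h4 h5]; split.
    * move=> j s4 ltj [h1 h2 h3 h4 h5]; split.
        by rewrite /= h2 h3 ltj modn_small.
      have hi4 : tables_stored tabs s4.
        by apply: tables_stored_frame hi h5 _ => q ltq; apply: h4; apply: leq_trans
          (leqW ltq) le.
      have hG4 : env_stored ((j, r.+1, (false, i)) :: G) s4 r.+3.
        move=> v q c' /= [[<- <- <-]|/hG [g1 g2 g3]].
          split; [exact: h2|exact: leqW|].
          by rewrite /class_bound /= mul1n; apply: leq_trans hN; apply: ltnW.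
        by split; [rewrite h4|lia|].
      apply: (runs_seq (IHf j r.+1 wf s4 r.+3 _ hi4 hG4)); first by lia.
      move=> s5 [x5 f5 m5].
      apply: runs_seq (runs_seteq _ _ _) _.
      move=> s6 ->; apply: runs_set; split=> /=.
      -- upds; rewrite x5 f5 ?h1; last by lia.
         by rewrite -(big_ord_recr j (fun x => den nv orc tabs (f x))) /= modn_small
           // hsum.
      -- upds; rewrite f5 ?h2; last by lia.
         by rewrite (modn_small w1) addn1 modn_small //; apply: leq_ltn_trans wN.
      -- by upds; rewrite f5 ?h3; lia.
      -- by move=> q ltq; upds; rewrite f5 ?h4 //; lia.
      -- by rewrite m5.
    * by move=> s4 [h1 h2 h3 h4 h5]; rewrite /= h2 h3 ltnn mod0n.
    * split=> /=; upds; rewrite ?mod0n ?big_ord0 //.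
      by move=> q ltq; upds; rewrite f1 //; lia.
    * by [].
  + have h1 := pow_gt0 ta; have h2 := pow_gt0 tf; have h3 := pow_gt0 i.
    apply: (@leq_trans (B ^ ta * B ^ tf * B ^ i * 2 ^ 5)).
      have : N * (4 + (B ^ tf + (4 + 4))) <= B ^ i * B ^ tf * 13.
        rewrite -mulnA leq_mul //; lia.
      have : 0 < B ^ i * B ^ tf by rewrite muln_gt0 h2 h3.
      rewrite -[B ^ ta * B ^ tf * B ^ i]mulnA [B ^ tf * _]mulnC.
      move: (B ^ i * B ^ tf) => y; move: (N * _) => z; move: (B ^ ta) h1 => x.
      nia.
    apply: (@leq_trans (B ^ (ta + tf + i + 5))).
      by rewrite !expnD leq_mul2l pow2_le orbT.
    by apply: pow_le; lia.
- move=> G a a' f f' ca cf ta tf oka IHa okf IHf hw s r le hi hG.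
  have wa : U * B ^ ta < 2 ^ w by apply: leq_ltn_trans hw; rewrite leq_mul ?pow_le; lia.
  have wf : U * B ^ tf < 2 ^ w by apply: leq_ltn_trans hw; rewrite leq_mul ?pow_le; lia.
  have hv v q c' : List.In (v, q, c') G -> v <= class_bound c' by case/hG.
  apply: runs_le.
    apply: (runs_seq (IHa wa s r le hi hG)) => s1 r1.
    have hi1 := tables_stored_result le hi r1; have [x1 f1 m1] := r1.
    have hG1 : env_stored ((den nv orc tabs a, r, ca) :: G) s1 r.+1.
      move=> v q c' /= [[<- <- <-]|/hG [g1 g2 g3]].
        by split; [|exact: leqnn|apply: den_le oka hv].
      by split; [rewrite f1|lia|].
    apply: (runs_seq (IHf _ _ wf s1 r.+1 _ hi1 hG1)); first by lia.
    move=> s2 [x2 f2 m2]; apply: runs_set.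
    by split=> /=; [upds|move=> q ltq; upds; rewrite f2 ?f1 //; lia|rewrite m2].
  by rewrite /= addnA; apply: pow3.
- move=> G q a a' ca c ta ltq oka IHa _ hw s r le hi hG.
  have wa : U * B ^ ta < 2 ^ w by apply: leq_ltn_trans hw; rewrite leq_mul ?pow_le; lia.
  apply: (runs_le (T := B ^ ta + (4 + 5))).
    apply: (runs_seq (IHa wa s r le hi hG)) => s1 r1.
    have hi1 := tables_stored_result le hi r1; have [x1 f1 m1] := r1.
    have [g1 g2 g3] := hi1.2 q ltq.
    apply: (runs_if (a := Bin Lt _ _)); rewrite /= x1 g1.
    have w1 : U * B ^ 0 < 2 ^ w by apply: leq_ltn_trans wa; rewrite leq_mul ?pow_le.
    rewrite modn_small; last first.
      by apply: leq_ltn_trans w1; rewrite muln1; case: (_ < _).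
    case: ltnP => /= hlt; [|apply: (runs_le (T := 2)) => //]; apply: runs_set.
      split=> /=; [upds|by move=> q' ltq'; upds; rewrite f1|by rewrite m1].
      by rewrite x1 modn_small ?g3 //; apply: ltn_trans g2; rewrite ltn_add2l.
    by split=> /=; [upds; rewrite mod0n nth_default|move=> q' ltq'; upds; rewrite
      f1|rewrite m1].
  by rewrite /=; apply: pow1.
- move=> G q a a' ca ta ltq oka IHa hw s r le hi hG.
  have wa : U * B ^ ta < 2 ^ w by apply: leq_ltn_trans hw; rewrite leq_mul ?pow_le; lia.
  have hv v q' c' : List.In (v, q', c') G -> v <= class_bound c' by case/hG.
  have wn : den nv orc tabs a + nv < 2 ^ w.
    apply: leq_ltn_trans hw; apply: (@leq_trans (U * B ^ (ca.2 + 1) + U * B ^ (ca.2 + 1))).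
      apply: leq_add; first by apply: leq_trans (den_le htab oka hv) (class_bound_le
        _); lia.
      apply: leq_trans nvB (leq_trans _ (leq_pmull _ U0)).
      by rewrite -{1}[B]expn1; apply: pow_le; lia.
    rewrite addnn -mul2n mulnCA leq_mul2l; apply/orP; right.
    by apply: leq_trans (leq_mul B2 (leqnn _)) _; rewrite -expnS; apply: pow_le; lia.
  apply: (runs_le (T := B ^ ta + (6 + 4))).
    apply: (runs_seq (IHa wa s r le hi hG)) => s1 r1.
    have hi1 := tables_stored_result le hi r1; have [x1 f1 m1] := r1.
    have [g1 g2 g3] := hi1.2 q ltq.
    apply: (runs_if (a := Bin Lt _ _)); rewrite /= x1 g1 hi1.1 (modn_small wn).
    have w1 : U * B ^ 0 < 2 ^ w by apply: leq_ltn_trans wa; rewrite leq_mul ?pow_le.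
    rewrite modn_small; last first.
      by apply: leq_ltn_trans w1; rewrite muln1; case: (_ < _).
    case: ltnP => /= hlt; [apply: (runs_le (T := 2)) => //; apply: runs_set|apply:
      runs_query].
      by split=> /=; [upds; rewrite mod0n|move=> q' ltq'; upds; rewrite f1|rewrite m1].
    split=> /=; [upds|by move=> q' ltq'; upds; rewrite f1|by rewrite m1].
    case: (posnP nv) => [nv0|nvp].
      by apply: orcE => i; rewrite nv0.
    apply: orcE => i lti; rewrite x1 modn_small.
      by rewrite -addnA g3 //; apply: leq_trans hlt; rewrite ltn_add2l.
    apply: ltn_trans g2; rewrite ltn_add2l; apply: leq_trans hlt.
    by rewrite -[X in X < _]addn0 ltn_add2l.
  by apply: leq_trans (@pow1 ta ca.2 10 isT) _; apply: pow_le; lia.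
Qed.

(** This protects the finished tables: a new one is written from the first free address on. *)
Definition tables_below (tabs : seq (seq nat)) (s : state) :=
  forall q, q < size tabs ->
    regs s (2 * q) + size (nth [::] tabs q) <= regs s regf.

Ltac rlia := unfold reg0, regf, regn, ntabs in *; lia.

(** U enters the time only through the number of entries, each of which costs a power of B. The last
    conclusion tracks the first free address, so that addresses fit into words. *)
Lemma phase_runs tabs N N' f f' cN tN cf tf e s :
  size tabs < ntabs ->
  bounded_term [::] N N' cN tN ->
  (forall v r, bounded_term [:: (v, r, cN)] (f v) (f' r) cf tf) ->
  tables_le tabs -> tables_le (rcons tabs (fill nv orc tabs (den nv orc tabs N) f)) ->
  tables_stored tabs s -> tables_below tabs s -> regs s regf <= U * B ^ e ->
  U * B ^ (e + tN + tf + 5) < 2 ^ w ->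
  runs (phase (size tabs) (N', f')) s (class_bound cN * B ^ (tN + tf + 5))
    (fun s' =>
       let tabs' := rcons tabs (fill nv orc tabs (den nv orc tabs N) f) in
       [/\ tables_stored tabs' s', tables_below tabs' s' & regs s' regf <= U * B ^ (e
         + cN.2 + 1)]).
Proof.
move=> hq okN okf htab htab' hi hf he hw.
set q := size tabs in hq *.
have hreg : (2 * q).+1 < regn by rewrite /regn; lia.
have wN : U * B ^ tN < 2 ^ w by apply: leq_ltn_trans hw; rewrite leq_mul ?pow_le; lia.
have wf : U * B ^ tf < 2 ^ w by apply: leq_ltn_trans hw; rewrite leq_mul ?pow_le; lia.
have hN : den nv orc tabs N <= class_bound cN by apply: (den_le htab okN).
set n := den nv orc tabs N in hN htab' *.
have hend : regs s regf + n <= U * B ^ (e + cN.2 + 1).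
  apply: (@leq_trans (U * B ^ (e + cN.2) + U * B ^ (e + cN.2))).
    apply: leq_add; first by apply: leq_trans he _; rewrite leq_mul ?pow_le //; lia.
    by apply: leq_trans hN (class_bound_le _); lia.
  by rewrite addnn -mul2n mulnCA addn1 expnS leq_mul // leq_mul.
have hend1 : (regs s regf + n).+1 < 2 ^ w.
  apply: leq_ltn_trans hw; apply: (@leq_trans (U * B ^ (e + cN.2 + 1) + U * B ^ (e +
    cN.2 + 1))).
    by rewrite -addn1; apply: leq_add => //; rewrite muln_gt0 U0 pow_gt0.
  rewrite addnn -mul2n mulnCA leq_mul //; apply: leq_trans (leq_mul B2 (leqnn _)) _.
  by rewrite -expnS pow_le //; have := bounded_term_class okN; lia.
have w1 : 1 < 2 ^ w by apply: leq_ltn_trans hend1.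
pose part j := fill nv orc tabs j f.
have hpart j : j <= n -> tables_le (rcons tabs (part j)).
  move=> lej p i; have := htab' p i; rewrite !nth_rcons.
  case: ltngtP => // _; case: (ltnP i j) => [ltij|leji].
    by rewrite /part (nth_fill_prefix _ _ _ _ ltij lej).
  by rewrite (@nth_default _ 0 (part j)) // /part size_fill.
have psz j : size (part j) = j by rewrite size_fill.
have pS j : part j.+1 = rcons (part j) (den nv orc (rcons tabs (part j)) (f j)).
  by rewrite /part /= size_fill.
have p0 : part 0 = [::] by [].
rewrite -/(part n) in htab' *; clearbody part.
apply: (runs_le (T := B ^ tN + (2 + ((n * (4 + (B ^ tf + (5 + 4))) + 4) + 4)))); last first.
  have hb : n * (4 + (B ^ tf + (5 + 4))) <= class_bound cN * B ^ tf * 14.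
    rewrite -mulnA leq_mul //; have := pow_gt0 tf; lia.
  apply: (@leq_trans (class_bound cN * (B ^ tN * B ^ tf * 2 ^ 5))).
    have : 0 < class_bound cN by rewrite /class_bound muln_gt0 pow_gt0 andbT; case: ifP.
    have := pow_gt0 tf; have := pow_gt0 tN.
    move: (n * _) hb => z; move: (B ^ tf) => y; move: (B ^ tN) => x; move:
      (class_bound cN) => b.
    move=> hz hx hy hb; apply: (@leq_trans (x + (2 + (b * y * 14 + 4 + 4)))); first by lia.
    have hby : 0 < b * y by rewrite muln_gt0 hb.
    rewrite -[x * y * _]mulnA [x * _]mulnC !mulnA.
    move: (b * y) hby => c hc; nia.
  by rewrite leq_mul // !expnD leq_mul // pow2_le.
apply: (runs_seq (compile_runs htab okN wN (r := reg0) (leqnn _) hi _)) => [v r c []|s1 r1].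
have hi1 := tables_stored_result (leqnn _) hi r1; have [x1 f1 m1] := r1.
apply: runs_seq (runs_seteq _ _ _) _ => s2 ->.
pose J j (s' : state) :=
  [/\ tables_stored (rcons tabs (part j)) s', regs s' (2 * q) = regs s regf,
      regs s' reg0 = n, regs s' regf = regs s regf &
      forall p, p < q -> regs s' (2 * p) = regs s (2 * p)].
have hfs p : p < q -> regs s (2 * p) + size (nth [::] tabs p) <= regs s regf := @hf p.
have old j p : p < q -> nth [::] (rcons tabs (part j)) p = nth [::] tabs p.
  by move=> ltp; rewrite nth_rcons ltp.
have new j : nth [::] (rcons tabs (part j)) q = part j.
  by rewrite nth_rcons ltnn eqxx.
have rest j p : q < p -> nth [::] (rcons tabs (part j)) p = [::].
  by move=> ltp; rewrite nth_default // size_rcons.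
have rest0 p : q <= p -> nth [::] tabs p = [::] by move=> lep; rewrite nth_default.
apply: runs_seq.
- apply: (runs_while (N := n) (Tb := B ^ tf + (5 + 4)) (J := J)).
  + move=> j s3 ltj [h1 h2 h3 h4 h5].
    have [hl hl2 hl3] := h1.2 q hq; rewrite new psz in hl hl2 hl3.
    split; first by rewrite /= hl h3 ltj modn_small.
    have hG : env_stored [:: (j, (2 * q).+1, cN)] s3 reg0.+1.
      move=> v r c' /= [[<- <- <-]|//]; split; [exact: hl|rlia|].
      by apply: leq_trans hN; apply: ltnW.
    apply: (runs_seq (compile_runs (hpart j (ltnW ltj)) (okf j _) wf (leqnSn _) h1
      hG)) => s4 [x4 f4 m4].
    have hb4 : regs s4 (2 * q) = regs s regf by rewrite f4 //; rlia.
    have hl4 : regs s4 (2 * q).+1 = j by rewrite f4 //; rlia.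
    have hbj : regs s regf + j < 2 ^ w.
      by apply: leq_ltn_trans (ltnW hend1); lia.
    apply: runs_seq; first by apply: (runs_store (P := eq _)).
    move=> s5 <-; apply: runs_set; split; rewrite /= ?hb4 ?hl4 (modn_small w1) addn1.
    * rewrite (modn_small hbj) [j.+1 %% _]modn_small; last by apply: leq_ltn_trans
        (ltnW hend1); lia.
      split; first by rewrite /= upd_other ?f4 ?h1.1 //; rlia.
      move=> p ltp; have [g1 g2 g3] := h1.2 p ltp.
      have ltp2 : 2 * p < regn by rewrite /regn; lia.
      have ltp1 : (2 * p).+1 < regn by rewrite /regn; lia.
      have hp2 : regs s4 (2 * p) = regs s3 (2 * p) by rewrite f4 //; rlia.
      have hp1 : regs s4 (2 * p).+1 = regs s3 (2 * p).+1 by rewrite f4 //; rlia.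
      rewrite /= [upd _ _ _ (2 * p)]upd_other ?hp2; last by lia.
      case: (ltngtP p q) => [ltpq|ltqp|epq].
      -- rewrite old // in g1 g2 g3; rewrite old // upd_other ?hp1; last by lia.
         split=> // i lti; rewrite upd_other ?m4 ?g3 //.
         have := hfs p ltpq; rewrite -h5 //; lia.
      -- rewrite rest // in g1 g2 g3; rewrite rest // upd_other ?hp1; last by lia.
         by split.
      -- rewrite {p ltp ltp2 ltp1 hp2 hp1 g1 g2 g3}epq new h2 psz upd_same.
         split=> [//||i].
           by apply: leq_ltn_trans (ltnW hend1); lia.
         rewrite ltnS leq_eqVlt => /orP[/eqP ->|lti].
           by rewrite upd_same x4 pS nth_rcons psz ltnn eqxx.
         rewrite upd_other ?m4; last by lia.
         by rewrite -h2 hl3 // pS nth_rcons psz lti.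
    * by rewrite upd_other //; lia.
    * rewrite upd_other; last by rlia.
      by rewrite f4.
    * rewrite upd_other; last by rlia.
      by rewrite f4.
    * move=> p ltp; rewrite upd_other ?f4 ?h5 //; last by lia.
      rlia.
  + move=> s3 [h1 h2 h3 h4 h5].
    have [hl _ _] := h1.2 q hq; rewrite new psz in hl.
    by rewrite /= hl h3 ltnn mod0n.
  + have [g1 g2 g3] := hi1.2 q hq; rewrite rest0 //= in g1 g2 g3.
    split=> /=.
    * split; first by rewrite /= upd_other ?hi1.1 //; rlia.
      move=> p ltp; have [k1 k2 k3] := hi1.2 p ltp; case: (ltngtP p q) => [ltpq|ltqp|epq].
      -- by rewrite old //= !upd_other //; lia.
      -- rewrite rest0 in k1 k2 k3; last exact: ltnW.
         by rewrite rest //= !upd_other //; lia.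
      -- rewrite {p ltp k1 k2 k3}epq new p0 /= upd_same upd_other ?g1 //; last by lia.
         split=> //; rewrite addn0 f1 //; rlia.
    * by rewrite upd_same f1 //; rlia.
    * by rewrite upd_other ?x1 //; rlia.
    * by rewrite upd_other ?f1 //; rlia.
    * move=> p ltp; rewrite upd_other ?f1 //; last by lia.
      rlia.
- move=> s3 [h1 h2 h3 h4 h5]; apply: runs_set.
  have [hl hl2 hl3] := h1.2 q hq; rewrite new psz in hl hl2 hl3.
  have hs : regs s regf + n < 2 ^ w by apply: ltnW.
  rewrite /= h4 hl (modn_small hs); split.
  + apply: tables_stored_frame h1 _ _ => // i lti /=.
    by rewrite upd_other // neq_ltn lti.
  + move=> p; rewrite size_rcons ltnS => lep /=; rewrite upd_same upd_other; last first.
      by rlia.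
    move: lep; rewrite leq_eqVlt => /orP[/eqP -> | ltp].
      by rewrite new psz h2 leqnn.
    by rewrite old // h5 // (leq_trans (hfs p ltp)) ?leq_addr.
  + by rewrite /= upd_same.
Qed.

Definition cost_class_le (c c' : cost_class) := (c.1 ==> c'.1) && (c.2 <= c'.2).

(* The classes of its entries do not bound the table [fib_table] of Fibonacci numbers,
   which refers to itself under an addition. *)
Inductive bounded_phases : nat -> seq (term * (nat -> term)) -> nat -> Prop :=
  | PsNil q : bounded_phases q [::] 0
  | PsCons q N f cN tN cf tf ps E :
      bounded_term [::] N N cN tN -> (forall v r, bounded_term [:: (v, r, cN)] (f v)
        (f r) cf tf) ->
      (q == fib_table) || cost_class_le cf (nth (false, 0) tc q) ->
      bounded_phases q.+1 ps E -> bounded_phases q ((N, f) :: ps) (E + cN.2 + tN + tf + 6).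

Lemma fills_prefix ps tabs q : q < size tabs ->
  nth [::] (fills nv orc tabs ps) q = nth [::] tabs q.
Proof.
elim: ps tabs => //= -[N f] ps IH tabs ltq.
by rewrite IH ?size_rcons 1?ltnW // nth_rcons ltq.
Qed.

Lemma fills_le ps tabs : tables_le (fills nv orc tabs ps) -> tables_le tabs.
Proof.
move=> h q i; case: (ltnP q (size tabs)) => [ltq|leq].
  by rewrite -(fills_prefix ps ltq).
by rewrite (nth_default [::]) // nth_nil.
Qed.

Lemma tables_le_rcons tabs t : tables_le tabs ->
  (forall x, nth 0 t x <= class_bound (nth (false, 0) tc (size tabs))) ->
  tables_le (rcons tabs t).
Proof.
move=> htab ht q x; rewrite nth_rcons; case: ltnP => [_|_]; first exact: htab.
by case: eqP => [->|_]; rewrite ?nth_nil.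
Qed.

Lemma fills_tables_le q ps E : bounded_phases q ps E ->
  forall tabs, size tabs = q -> tables_le tabs ->
  (forall x, nth 0 (nth [::] (fills nv orc tabs ps) fib_table) x
             <= class_bound (nth (false, 0) tc fib_table)) ->
  tables_le (fills nv orc tabs ps).
Proof.
elim=> {q ps E} [//|q N f cN tN cf tf ps E okN okf hq _ IH] tabs hsz htab hfib /=.
apply: IH => //; first by rewrite size_rcons hsz.
apply: tables_le_rcons => //; rewrite hsz.
case: (eqVneq q fib_table) hq => [eq4 _ x|_ /= /andP[h1 h2]].
  have := hfib x; rewrite /= fills_prefix ?size_rcons ?hsz -?eq4 //.
  by rewrite nth_rcons hsz ltnn eqxx.
have hN : den nv orc tabs N <= class_bound cN by apply: (den_le htab okN).
elim: (den nv orc tabs N) hN => [|j IHj] lej x; first by rewrite nth_nil.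
have hj := IHj (ltnW lej); rewrite /= nth_rcons size_fill.
case: ltngtP => // _; apply: leq_trans (class_bound_mono h1 h2).
apply: (den_le (tables_le_rcons htab _) (okf j 0)) => [y|v r c /= [[<- _ <-]|//]].
  by rewrite hsz.
exact: ltnW.
Qed.

Lemma phases_runs ps q E c Tc Q : bounded_phases q ps E ->
  forall tabs s e, size tabs + size ps <= ntabs ->
  tables_le (fills nv orc tabs ps) -> tables_stored tabs s -> tables_below tabs s ->
  regs s regf <= U * B ^ e -> U * B ^ (e + E) < 2 ^ w ->
  (forall s', tables_stored (fills nv orc tabs ps) s' -> runs c s' Tc Q) ->
  runs (phases (size tabs) ps c) s (U * B ^ E + Tc) Q.
Proof.
elim=> {q ps E} [q|q N f cN tN cf tf ps E okN okf _ _ IH] tabs s e hsz htab hi hf he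
  hw hc /=.
  by apply: runs_le (hc s hi) _; rewrite leq_addl.
rewrite /= in hsz hw.
have hw1 : U * B ^ (e + tN + tf + 5) < 2 ^ w.
  by apply: leq_ltn_trans hw; rewrite leq_mul // pow_le //; lia.
have hlt : size tabs < ntabs by lia.
have htab' : tables_le (rcons tabs (fill nv orc tabs (den nv orc tabs N) f)).
  exact: (fills_le (ps := ps) htab).
have hp := phase_runs hlt okN okf (fills_le (ps := (N, f) :: ps) htab) htab' hi hf he hw1.
apply: (runs_le (T := class_bound cN * B ^ (tN + tf + 5) + (U * B ^ E + Tc))).
  apply: (runs_seq hp) => s1 [i1 f1 e1].
  rewrite -(size_rcons tabs (fill nv orc tabs (den nv orc tabs N) f)).
  apply: IH i1 f1 e1 _ _ => //; first by rewrite size_rcons; lia.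
  by apply: leq_ltn_trans hw; rewrite leq_mul // pow_le //; lia.
rewrite addnA leq_add2r.
apply: (@leq_trans (U * (B ^ (cN.2 + tN + tf + 5) + B ^ E))).
  rewrite mulnDr leq_add2r -!addnA (expnD _ cN.2) mulnA leq_mul //.
  exact: class_bound_le.
rewrite leq_mul //; apply: (@leq_trans (B ^ (cN.2 + tN + tf + 5) * B ^ E * B)).
  apply: leq_trans (leq_mul (leqnn _) B2).
  move: (pow_gt0 (cN.2 + tN + tf + 5)) (pow_gt0 E).
  by move: (B ^ _) => x; move: (B ^ _) => y; nia.
by rewrite -expnD -expnSr pow_le //; lia.
Qed.

End Bounds.

(** * The program *)

Coercion Cst : nat >-> term.
Local Notation "a ⊕ b" := (Op Add a b) (at level 50, left associativity).
Local Notation "a ⊖ b" := (Op Defs.Sub a b) (at level 50, left associativity).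
Local Notation "a ⊗ b" := (Op Mul a b) (at level 40, left associativity).
Local Notation "a ⊘ b" := (Op Div a b) (at level 40, left associativity).
Local Notation "a ≺ b" := (Op Lt a b) (at level 70).
Local Notation "a ≐ b" := (Op Eq a b) (at level 70).

Definition tn := Get 0 0.
Definition tm := Get 0 1.
Definition tp := Get 0 2.
Definition tk := Get 0 3.
Definition tF := Get 4 (2 ⊗ tk ⊕ 3).
Definition tL := 2 ⊗ tk ⊕ 2.
Definition tA := tm ⊗ tk.
(* Sums over walks are computed modulo [1, ..., tM], see [total_lt]. *)
Definition tM := 12 ⊗ ((tn ⊕ tm) ⊗ (tn ⊕ tm) ⊗ (tn ⊕ tm)).

Definition tedge u v := Get 0 (4 ⊕ (u ⊗ tn ⊕ v)).
Definition tdeg v := Sum tn (fun z => tedge v (Var z)).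
(** The least vertex number with degree below 2, i.e. an end of the path: it is the number of
    vertices [v] such that no [u <= v] has degree below 2. *)
Definition tstart :=
  Sum tn (fun v => Sum (Var v ⊕ 1) (fun u => tdeg (Var u) ≺ 2) ≐ 0).
(** The only nonzero summand is the neighbour of the previous vertex other than the one before it.
    For [x = 1] truncated subtraction makes both the start vertex, which is not its own neighbour,
    so nothing is excluded. *)
Definition tnext x :=
  Sum tn (fun v => Var v ⊗ (tedge (Get 1 (x ⊖ 1)) (Var v)
                            ⊗ (1 ⊖ (Var v ≐ Get 1 (x ⊖ 2))))).
(** On a path the outer [Rem] changes no value; it gives the class check a bound on the entries. *)
Definition order_phase := (tn, fun x => Rem (Ite (Var x) (tnext (Var x)) tstart) tn).

(** The index encodes (i, j, v) in mixed radix; each pair (i, j) owns [n] consecutive cells, the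
    characteristic vector of an interval, ready for an oracle query. *)
Definition interval_phase := ((tn ⊕ 1) ⊗ (tn ⊕ 1) ⊗ tn, fun x =>
  Let (Rem (Var x) (tn ⊖ 1)) (fun v => Let (Var x ⊘ tn) (fun z =>
  Let (Rem (Var z) tn) (fun j => Let (Var z ⊘ (tn ⊕ 1)) (fun i =>
  Rem (Sum tn (fun l => (Var i ≺ Var l ⊕ 1)
                        ⊗ ((Var l ≺ Var j) ⊗ (Get 1 (Var l) ≐ Var v)))) tn))))).

Definition winner_phase := ((tn ⊕ 1) ⊗ (tn ⊕ 1), fun x => Rem (Ask 2 (Var x ⊗ tn)) tm).

Definition fib_phase := (2 ⊗ tk ⊕ 4, fun x =>
  Ite (Var x ≺ 2) (Var x) (Get 4 (Var x ⊖ 1) ⊕ Get 4 (Var x ⊖ 2))).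

Definition binomial_phase := (tM ⊗ ((tA ⊕ 1) ⊗ (tk ⊕ 1)), fun x =>
  Let (Rem (Var x) tk) (fun i => Let (Var x ⊘ (tk ⊕ 1)) (fun z =>
  Let (Rem (Var z) tA) (fun a => Let (Rem (Var z ⊘ (tA ⊕ 1)) (tM ⊖ 1)) (fun mu =>
  Rem (Ite (Var i)
        (Ite (Var a) (Get 5 (Var x ⊖ (tk ⊕ 1) ⊖ 1) ⊕ Get 5 (Var x ⊖ (tk ⊕ 1))) 0)
        1) (Var mu)))))).

Definition tlead l y := y ≺ Get 4 (l ⊖ 1).

(** The word of length l and code y has index l F + y. Removing a leading bar keeps the code and
    lowers the index by 2 F; removing a leading star lowers it by F + fib (l - 1). *)
Definition bars_phase := (tL ⊗ tF, fun x =>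
  Let (Rem (Var x) (tF ⊖ 1)) (fun y => Let (Rem (Var x ⊘ tF) (tL ⊖ 1)) (fun l =>
  Rem (Ite (Var l)
        (Ite (tlead (Var l) (Var y)) (1 ⊕ Get 6 (Var x ⊖ 2 ⊗ tF))
           (Get 6 (Var x ⊖ (tF ⊕ Get 4 (Var l ⊖ 1)))))
        0) tL))).

Definition insert_phase := (tL ⊗ tF ⊗ (tk ⊕ 1), fun x =>
  Let (Rem (Var x) tk) (fun s => Let (Var x ⊘ (tk ⊕ 1)) (fun z =>
  Let (Rem (Var z) (tF ⊖ 1)) (fun y => Let (Rem (Var z ⊘ tF) (tL ⊖ 1)) (fun l =>
  Rem (Ite (Get 6 (Var z) ≐ Var s) (Get 4 (Var l) ⊕ Var y)
        (Ite (tlead (Var l) (Var y)) (Get 7 (Var x ⊖ 2 ⊗ tF ⊗ (tk ⊕ 1)))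
           (Get 4 (Var l) ⊕ Get 7 (Var x ⊖ (tF ⊕ Get 4 (Var l ⊖ 1)) ⊗ (tk ⊕ 1)))))
      tF))))).

(** A star for node t contributes t - a, which is t + mu a modulo mu + 1. *)
Definition product_phase := (tM ⊗ ((tA ⊕ 1) ⊗ (tL ⊗ tF)), fun x =>
  Let (Rem (Var x) (tL ⊗ tF ⊖ 1)) (fun t => Let (Var x ⊘ (tL ⊗ tF)) (fun z =>
  Let (Rem (Var t) (tF ⊖ 1)) (fun y => Let (Rem (Var t ⊘ tF) (tL ⊖ 1)) (fun l =>
  Let (Rem (Var z) tA) (fun a => Let (Rem (Var z ⊘ (tA ⊕ 1)) (tM ⊖ 1)) (fun mu =>
  Rem (Ite (Var l)
        (Ite (tlead (Var l) (Var y)) (Get 8 (Var x ⊖ 2 ⊗ tF))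
           ((Get 6 (Var t) ⊕ Var mu ⊗ Var a)
            ⊗ Get 8 (Var x ⊖ (tF ⊕ Get 4 (Var l ⊖ 1)))))
        1) (Var mu)))))))).

Definition tbars l y := Get 6 (l ⊗ tF ⊕ y).
Definition tins l y s := Get 7 ((l ⊗ tF ⊕ y) ⊗ (tk ⊕ 1) ⊕ s).
Definition tbin mu a r := Get 5 ((mu ⊗ (tA ⊕ 1) ⊕ a) ⊗ (tk ⊕ 1) ⊕ r).
Definition tprod mu a l y := Get 8 ((mu ⊗ (tA ⊕ 1) ⊕ a) ⊗ (tL ⊗ tF) ⊕ (l ⊗ tF ⊕ y)).
Definition tval mu h i j y :=
  Get 9 ((((mu ⊗ (tk ⊕ 1) ⊕ h) ⊗ (tn ⊕ 1) ⊕ i) ⊗ (tk ⊕ 1) ⊕ j) ⊗ tF ⊕ y).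
(* Modulo [mu + 1], [mu] is [-1]. *)
Definition tsign mu e := Rem e 1 ⊗ mu ⊕ Rem (e ⊕ 1) 1.
Definition tlag mu d a s :=
  Sum d (fun r => tsign mu (Var r ⊕ s) ⊗ (tbin mu a (Var r) ⊗ tbin mu (Var r) s)).

Definition tstep mu h i j y l :=
  Let (tbars l y) (fun d =>
  Ite i
    (Sum i (fun i' => Let (Get 3 (Var i' ⊗ (tn ⊕ 1) ⊕ i)) (fun q =>
      Ite (Var q ≐ tp)
        (Ite j (tval mu h (Var i') (j ⊖ 1) y) 0)
        (Sum (h ⊖ 1) (fun c => Let (Var q ⊗ (h ⊖ 1) ⊕ Var c) (fun a =>
          tprod mu (Var a) l y ⊗
          Sum (Var d) (fun s1 => Sum (Var d) (fun s2 =>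
            tlag mu (Var d) (Var a) (Var s1) ⊗ tlag mu (Var d) (Var a) (Var s2) ⊗
            tval mu h (Var i') j (tins (l ⊕ 1) (tins l y (Var s2)) (Var s1))))))))))
    ((j ≐ 0) ⊗ (Var d ≐ 0))).

Definition treduce mu h i j y l :=
  Let (tbars l y) (fun d => Sum (Var d) (fun s =>
    tlag mu (Var d) (Var d) (Var s) ⊗ tval mu h i j (tins l y (Var s)))).

(** The index has no component for the length of the word, which is l + 2 with l = 2 (k - h). The
    word starts with a bar iff its code is below fib (l + 1); then [tstep] performs [walk_sumS],
    otherwise [treduce] performs [walk_sum_star]. *)
Definition walk_phase := (tM ⊗ ((tk ⊕ 1) ⊗ ((tn ⊕ 1) ⊗ ((tk ⊕ 1) ⊗ tF))), fun x =>
  Let (Rem (Var x) (tF ⊖ 1)) (fun y => Let (Var x ⊘ tF) (fun z1 =>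
  Let (Rem (Var z1) tk) (fun j => Let (Var z1 ⊘ (tk ⊕ 1)) (fun z2 =>
  Let (Rem (Var z2) tn) (fun i => Let (Var z2 ⊘ (tn ⊕ 1)) (fun z3 =>
  Let (Rem (Var z3) tk) (fun h => Let (Rem (Var z3 ⊘ (tk ⊕ 1)) (tM ⊖ 1)) (fun mu =>
  Let (2 ⊗ (tk ⊖ Var h)) (fun l =>
  Rem (Ite (Var y ≺ Get 4 (Var l ⊕ 1))
        (tstep (Var mu) (Var h) (Var i) (Var j) (Var y) (Var l))
        (treduce (Var mu) (Var h) (Var i) (Var j) (Var y ⊖ Get 4 (Var l ⊕ 1))
           (Var l ⊕ 1)))
      (Var mu))))))))))).

Definition tans := 0 ≺ Sum tM (fun mu => Sum tk (fun s =>
  Rem (tval (Var mu) (Var s ⊕ 1) tn (Var s ⊕ 1) 0) (Var mu))).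

(** A constant z is counted as B^z. So the modulus bound [tM], 12 times three factors n + m of
    exponent 2, has exponent 12 + 6 = 18, and [tL] has exponent 4. Only Fibonacci numbers and codes
    of words contain U. *)
Definition table_classes : seq cost_class :=
  [:: (false, 1); (false, 1); (false, 1); (false, 1); (true, 0); (false, 18);
      (false, 4); (true, 0); (false, 18); (false, 18)].

Ltac solve_in := cbn [List.In]; first [left; reflexivity | right; solve_in].
Ltac solve_ok := intros; cbv beta;
  match goal with
  | |- bounded_term _ _ (Var _) _ _ _ => eapply OkVar; solve_in
  | |- bounded_term _ _ (Cst _) _ _ _ => eapply OkCst
  | |- bounded_term _ _ (Op _ _ _) _ _ _ => eapply OkOp;
    [solve_ok|solve_ok|vm_compute; reflexivity]
  | |- bounded_term _ _ (Rem _ _) _ _ _ => eapply OkRem; solve_ok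
  | |- bounded_term _ _ (Ite _ _ _) _ _ _ => eapply OkIte;
    [solve_ok|solve_ok|solve_ok|vm_compute; reflexivity]
  | |- bounded_term _ _ (Sum _ _) _ _ _ => eapply OkSum;
    [solve_ok|reflexivity|solve_ok|vm_compute; reflexivity]
  | |- bounded_term _ _ (Let _ _) _ _ _ => eapply OkLet; [solve_ok|solve_ok]
  | |- bounded_term _ _ (Get _ _) _ _ _ => eapply OkGet;
    [reflexivity|solve_ok|vm_compute; reflexivity]
  | |- bounded_term _ _ (Ask _ _) _ _ _ => eapply OkAsk; [reflexivity|solve_ok]
  end.

Definition all_phases := [:: order_phase; interval_phase; winner_phase; fib_phase;
  binomial_phase; bars_phase; insert_phase; product_phase; walk_phase].




Ltac unfold_terms := cbv [fst snd tn tm tp tk tF tL tA tM tedge tdeg tstart tnext tlead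
  tbars tins tbin tprod tval tsign tlag tstep treduce].

(** Unification with the rules computes [E]; as a number fixed independently of the instance it is
    all that the polynomial factor requires. *)
Lemma bounded_all_phases : exists E, bounded_phases table_classes 1 all_phases E.
Proof.
eexists; rewrite /all_phases /order_phase /interval_phase /winner_phase /fib_phase
  /binomial_phase /bars_phase /insert_phase /product_phase /walk_phase; unfold_terms.
do 9!(eapply PsCons; [solve_ok|solve_ok|reflexivity|]); apply PsNil.
Qed.

Lemma bounded_tans : exists e, bounded_term table_classes [::] tans tans (false, 0) e.
Proof. eexists; rewrite /tans; unfold_terms; solve_ok. Qed.

(** * Contents of the tables *)

Lemma pack_mod z D i : i < D -> (z * D + i) %% D = i.
Proof. by move=> lt; rewrite modnMDl modn_small. Qed.

Lemma pack_div z D i : i < D -> (z * D + i) %/ D = z.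
Proof.
by move=> lt; rewrite divnMDl ?(leq_ltn_trans _ lt) // divn_small // addn0.
Qed.

Lemma pack_lt z Z D i : z < Z -> i < D -> z * D + i < Z * D.
Proof. by move=> ltz lti; rewrite (@leq_trans (z.+1 * D)) ?leq_mul // mulSn addnC
  ltn_add2r. Qed.

Lemma subn1K D : 0 < D -> (D - 1).+1 = D.
Proof. by rewrite subn1 => /prednK. Qed.

Section Tables.
Variables (nv : nat) (orc : (nat -> nat) -> nat).

Definition ftab tabs (ph : term * (nat -> term)) :=
  fill nv orc tabs (den nv orc tabs ph.1) ph.2.

Definition tabspec tabs (ph : term * (nat -> term)) (t : seq nat) :=
  forall x, x < den nv orc tabs ph.1 ->
  exists2 s, nth 0 t x = den nv orc (rcons tabs s) (ph.2 x) &
             forall j, j < x -> nth 0 s j = nth 0 t j.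

Lemma tabspec_ftab tabs ph : tabspec tabs ph (ftab tabs ph).
Proof.
move=> x ltx; exists (fill nv orc tabs x ph.2); first exact: nth_fill.
by move=> j ltj; apply: nth_fill_prefix => //; apply: ltnW.
Qed.

Variables (n m p k : nat) (t0 t1 t2 t3 t4 t5 t6 t7 t8 t9 : seq nat).
Hypotheses (e0 : nth 0 t0 0 = n) (e1 : nth 0 t0 1 = m)
  (e2 : nth 0 t0 2 = p) (e3 : nth 0 t0 3 = k).
Hypotheses (n0 : 0 < n) (k0 : 0 < k).

Notation A := (m * k).
Notation M := (12 * ((n + m) * (n + m) * (n + m))).
Notation F := (fib (2 * k + 3)).
Notation L := (2 * k + 2).

Hypothesis h4 : tabspec [:: t0; t1; t2; t3] fib_phase t4.

Lemma t4_nth x : x < 2 * k + 4 -> nth 0 t4 x = fib x.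
Proof.
elim/ltn_ind: x => x IH ltx; have [|s -> hs] := h4 (x := x); first by rewrite /= e3.
case: x IH ltx hs => [|[|x]] IH ltx hs //=.
by rewrite subn1 subn2 /= (hs x.+1) // (hs x) // !IH // ltnW // ltnW.
Qed.

Lemma t4F : nth 0 t4 (2 * k + 3) = F.
Proof. by rewrite t4_nth //; lia. Qed.

Lemma F_gt0 : 0 < F.
Proof. by rewrite addn3 fib_gt0. Qed.

Lemma M_gt0 : 0 < M.
Proof. by rewrite !muln_gt0 addn_gt0 n0. Qed.

Hypothesis h5 : tabspec [:: t0; t1; t2; t3; t4] binomial_phase t5.

Lemma t5_nth mu a i : mu < M -> a <= A -> i <= k ->
  nth 0 t5 ((mu * A.+1 + a) * k.+1 + i) = 'C(a, i) %% mu.+1.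
Proof.
move=> ltmu; elim: a i => [|a IH] i lea lei; set x := (_ * _ + i);
  have [|s -> hs] := h5 (x := x);
  try by rewrite /= e0 e1 e3 !addn1 mulnA !pack_lt.
all: rewrite /= e0 e1 e3 !addn1 subn1K ?M_gt0 //.
all: rewrite {1 3 4}/x pack_mod ?pack_div // pack_mod ?pack_div // (modn_small ltmu) //=.
  by case: i lei @x hs.
case: i lei @x hs => [|i] lei x hs //=.
rewrite hs ?hs; try by rewrite /x; lia.
rewrite (_ : x - k.+1 = (mu * A.+1 + a) * k.+1 + i.+1); last by rewrite /x; lia.
rewrite (_ : _ - 1 = (mu * A.+1 + a) * k.+1 + i); last by lia.
by rewrite !IH ?(ltnW lea) ?(ltnW lei) // modnDm addnC -binS.
Qed.

Hypothesis h6 : tabspec [:: t0; t1; t2; t3; t4; t5] bars_phase t6.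

Lemma enc_lt_F u : wlen u <= L -> enc u < F.
Proof. by move=> le; apply: leq_trans (enc_lt u) _; apply: leq_fib; lia. Qed.

Lemma t6_cell l y : l < L -> y < F -> let x := l * F + y in
  nth 0 t6 x = (if l is l'.+1 then
                  if y < fib l' then 1 + nth 0 t6 (x - 2 * F)
                  else nth 0 t6 (x - (F + fib l'))
                else 0) %% L.+1.
Proof.
move=> ltl lty x; have FF := F_gt0.
have [|s -> hs] := h6 (x := x); first by rewrite /= e3 t4F pack_lt.
rewrite /= e3 t4F !subn1K ?F_gt0 //; last by lia.
rewrite pack_mod // pack_div // (modn_small ltl).
case: l ltl @x hs => [|l] ltl x hs //=; rewrite subn1 /= t4_nth; last by lia.
case: (_ < _); rewrite /= hs // /x; lia.
Qed.

Lemma t6_nth u : wlen u < L -> nth 0 t6 (wlen u * F + enc u) = bars u.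
Proof.
have FF := F_gt0.
elim: u => [|[] v IH] ltu; have lty := enc_lt_F (ltnW ltu).
- by rewrite t6_cell //= mod0n.
- have hn := bars_wlen v; rewrite [wlen _]/= [enc _]/= [bars _]/= in ltu lty *.
  rewrite !add2n !add0n in ltu lty *; rewrite t6_cell // enc_lt.
  rewrite (_ : _ - _ = wlen v * F + enc v); last by lia.
  by rewrite IH ?modn_small //; lia.
- have hn := bars_wlen v; rewrite [wlen _]/= [enc _]/= [bars _]/= in ltu lty *.
  rewrite !add1n in ltu lty *; rewrite t6_cell // ltnNge leq_addr /=.
  rewrite (_ : _ - _ = wlen v * F + enc v); last by lia.
  by rewrite IH ?modn_small //; lia.
Qed.

Hypothesis h7 : tabspec [:: t0; t1; t2; t3; t4; t5; t6] insert_phase t7.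

(** For l > 0 the index is positive, so the truncated subtractions lead to an earlier cell; for the
    empty word the first branch must apply. *)
Lemma t7_cell l y q : l < L -> y < F -> q <= k ->
  let z := l * F + y in let x := z * k.+1 + q in (0 < l) || (nth 0 t6 z == q) ->
  nth 0 t7 x = (if nth 0 t6 z == q then fib l + y else
                if y < fib (l - 1) then nth 0 t7 (x - 2 * F * k.+1)
                else fib l + nth 0 t7 (x - (F + fib (l - 1)) * k.+1)) %% F.+1.
Proof.
move=> ltl lty leq z x; have FF := F_gt0.
have ltx : x < L * F * k.+1 by rewrite !pack_lt.
have [|s -> hs] := h7 (x := x); first by rewrite /= e3 t4F addn1.
rewrite /= e3 t4F !addn1 !subn1K ?F_gt0 //; last by lia.
rewrite pack_mod // pack_div // pack_mod // pack_div // (modn_small ltl).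
rewrite !t4_nth ?eqb0 ?negbK; try lia.
case: ifP => // _; rewrite orbF => l0.
have x0 : 0 < x by rewrite /x /z addn_gt0 muln_gt0 addn_gt0 muln_gt0 l0 FF.
by rewrite !hs // ltn_subrL x0 !muln_gt0 ?addn_gt0 FF.
Qed.

Lemma t7_nth u q : wlen u < L -> q <= bars u ->
  nth 0 t7 ((wlen u * F + enc u) * k.+1 + q) = enc (ins q u).
Proof.
have FF := F_gt0.
elim: u q => [|b v IH] q ltu leq; have lty := enc_lt_F (ltnW ltu).
  move: leq; rewrite leqn0 => /eqP ->.
  by rewrite t7_cell ?(@t6_nth [::]) //= ?mod0n // addn2.
have hn := bars_wlen (b :: v); have hw := wlen_ins leq.
have hlt : enc (ins q (b :: v)) < F.+1.
  by apply: leq_trans (enc_lt _) _; apply: leqW; apply: leq_fib; rewrite hw; lia.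
have leqk : q <= k by lia.
rewrite t7_cell // ?t6_nth //; last by case: (b).
rewrite [ins _ _]/= in hlt *; case: eqP leq => [_|/eqP ne] leq in hlt *.
  by rewrite /= in hlt *; rewrite modn_small.
rewrite -[RHS](modn_small hlt); congr (_ %% _).
case: b ltu lty hn hw hlt ne leq => ltu lty hn hw hlt ne leq.
- have leq' : q <= bars v by rewrite /= in ne leq; lia.
  rewrite [wlen _]/= [enc (true :: v)]/= !add2n !add0n enc_lt [RHS]/= add0n -IH //;
    last first.
    by rewrite /= in ltu; lia.
  by congr nth; lia.
- have leq' : q <= bars v by rewrite /= in ne leq; lia.
  rewrite [wlen _]/= [enc (false :: v)]/= !add1n subn1 /= ltnNge leq_addr /= wlen_ins
    // -IH //; last first.
    by rewrite /= in ltu; lia.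
  by congr (_ + nth _ _ _); lia.
Qed.

Hypothesis h8 : tabspec [:: t0; t1; t2; t3; t4; t5; t6; t7] product_phase t8.

Lemma t8_cell mu a l y : mu < M -> a <= A -> l < L -> y < F ->
  let z := l * F + y in let x := (mu * A.+1 + a) * (L * F) + z in
  nth 0 t8 x = (if l is l'.+1 then
                  if y < fib l' then nth 0 t8 (x - 2 * F)
                  else (nth 0 t6 z + mu * a) * nth 0 t8 (x - (F + fib l'))
                else 1) %% mu.+1.
Proof.
move=> ltmu lea ltl lty z x; have FF := F_gt0.
have ltz : z < L * F by rewrite pack_lt.
have ltx : x < M * (A.+1 * (L * F)) by rewrite mulnA !pack_lt.
have LF0 : 0 < L * F by apply: leq_ltn_trans ltz.
have [|s -> hs] := h8 (x := x); first by rewrite /= e0 e1 e3 t4F addn1.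
rewrite /= e0 e1 e3 t4F !addn1 !subn1K ?F_gt0 ?M_gt0 //; last by lia.
rewrite [x %% _](pack_mod _ ltz) [x %/ _](pack_div _ ltz) [z %% _](pack_mod _ lty).
rewrite [z %/ _](pack_div _ lty) !pack_mod // pack_div // (modn_small ltl)
  (modn_small ltmu).
case: l ltl @z @x ltz ltx hs => [|l] ltl z x ltz ltx hs //=.
rewrite subn1 /= t4_nth ?eqb0 ?negbK; last by lia.
have x0 : 0 < x by rewrite /x /z addn_gt0 addn_gt0 !muln_gt0 FF /= orbT.
by rewrite !hs // ltn_subrL x0 ?muln_gt0 ?addn_gt0 FF.
Qed.

(** * Table entries as elements of a ring in which mu + 1 vanishes *)

Section Mod.
Import GRing.Theory.
Local Open Scope ring_scope.
Variables (R : comNzRingType) (mu : nat).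
Hypothesis hmu : mu.+1%:R = 0 :> R.
Hypothesis ltmu : (mu < M)%N.

Lemma natr_mod x : (x %% mu.+1)%:R = x%:R :> R.
Proof. by rewrite [in RHS](divn_eq x mu.+1) natrD natrM hmu mulr0 add0r. Qed.

Lemma natr_mu : mu%:R = -1 :> R.
Proof. by apply/eqP; rewrite -addr_eq0 natr1 hmu. Qed.

Lemma t8_nth a u : (a <= A)%N -> (wlen u < L)%N ->
  (nth 0%N t8 ((mu * A.+1 + a) * (L * F) + (wlen u * F + enc u)))%:R = star_prod R [:: a] u.
Proof.
move=> lea; have FF := F_gt0.
elim: u => [|[] v IH] ltu; have lty := enc_lt_F (ltnW ltu).
- by rewrite t8_cell // natr_mod.
- rewrite [wlen _]/= [enc _]/= in ltu lty *.
  rewrite !add2n !add0n in ltu lty *; rewrite t8_cell // enc_lt natr_mod /= mul1r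
    -IH; last by lia.
  by congr (nth _ _ _)%:R; lia.
- have h := t6_nth ltu; rewrite [wlen _]/= [enc _]/= [bars _]/= in ltu lty h *.
  rewrite !add1n in ltu lty h *; rewrite t8_cell // h natr_mod ltnNge leq_addr /=.
  rewrite natrM natrD natrM natr_mu /root_prod big_seq1 add0n mulN1r -IH; last by lia.
  by congr (_ * (nth _ _ _)%:R); lia.
Qed.


Hypothesis m0 : (0 < m)%N.

Lemma sgn_den e : ((e %% 2) * mu + (e + 1) %% 2)%:R = sgn R e.
Proof.
rewrite !modn2 natrD natrM natr_mu /sgn -signr_odd addn1 /=.
by case: (odd e) => /=; ring.
Qed.

Lemma lag_den d a q : (d <= k)%N -> (a <= A)%N -> (q <= k)%N ->
  (\sum_(r < d) ((r + q) %% 2 * mu + (r + q + 1) %% 2) *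
     (nth 0 t5 ((mu * A.+1 + a) * k.+1 + r) * nth 0 t5 ((mu * A.+1 + r) * k.+1 + q)))%N%:R
  = lag R d a q.
Proof.
move=> led lea leq; rewrite natr_sum; apply: eq_bigr => r _.
have ler : (r <= k)%N by apply: leq_trans led; apply: ltnW.
have lerA : (r <= A)%N by apply: leq_trans ler _; rewrite leq_pmull.
by rewrite natrM sgn_den natrM !t5_nth // !natr_mod.
Qed.

Variable col : nat -> nat -> nat.
Hypothesis col_lt : forall x y, (col x y < m)%N.
Hypothesis h3 : forall x y, (x < y)%N -> (y <= n)%N -> nth 0%N t3 (x * n.+1 + y) = col x y.
Hypothesis h9 : tabspec [:: t0; t1; t2; t3; t4; t5; t6; t7; t8] walk_phase t9.

Definition vidx h i j y := ((((mu * k.+1 + h) * n.+1 + i) * k.+1 + j) * F + y)%N.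

(** A step to a smaller end vertex may raise the code and still reads an earlier cell, because [i]
    is the more significant digit. [vidx_y] is the other dependency, a smaller code at the same
    vertex. *)
Lemma vidx_i h i i' j j' y y' : (i' < i)%N -> (j' <= k)%N -> (y' < F)%N ->
  (vidx h i' j' y' < vidx h i j y)%N.
Proof.
move=> lti lej lty; apply: (@leq_trans (((mu * k.+1 + h) * n.+1 + i) * k.+1 * F)%N).
  by rewrite pack_lt // pack_lt // ltn_add2l.
rewrite /vidx; move: ((mu * k.+1 + h) * n.+1 + i)%N => z.
by rewrite mulnDl -addnA leq_addr.
Qed.

Lemma vidx_y h i j y y' : (y' < y)%N -> (vidx h i j y' < vidx h i j y)%N.
Proof. by rewrite /vidx ltn_add2l. Qed.

Section Eval.
Variable s : seq nat.
Notation TS := [:: t0; t1; t2; t3; t4; t5; t6; t7; t8; s].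
Notation D := (den nv orc TS).

Lemma den_Let a f v : D a = v -> D (Let a f) = D (f v).
Proof. by move=> <-. Qed.

Lemma den_Sum a f : D (Sum a f) = (\sum_(x < D a) D (f x))%N.
Proof. by []. Qed.

Lemma den_Ite a b c : D (Ite a b c) = if D a != 0%N then D b else D c.
Proof. by []. Qed.

Lemma den_Rem a b : D (Rem a b) = (D a %% (D b).+1)%N.
Proof. by []. Qed.

Lemma den_Mul a b : D (Op Mul a b) = (D a * D b)%N.
Proof. by []. Qed.

Lemma den_tF : D tF = F.
Proof. by rewrite /= e3 t4F. Qed.

Lemma den_tbars l y v : D l = wlen v -> D y = enc v -> (wlen v < L)%N ->
  D (tbars l y) = bars v.
Proof.
move=> hl hy ltv; rewrite -[D _]/(nth 0%N t6 (D l * D tF + D y))%N hl hy den_tF.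
exact: t6_nth.
Qed.

Lemma den_tins l y q v : D l = wlen v -> D y = enc v -> (wlen v < L)%N ->
  (D q <= bars v)%N -> D (tins l y q) = enc (ins (D q) v).
Proof.
move=> hl hy ltv leq.
rewrite -[D _]/(nth 0%N t7 ((D l * D tF + D y) * (D tk + 1) + D q))%N hl hy den_tF.
by rewrite [D tk]e3 addn1 t7_nth.
Qed.

Lemma den_tprod a l y v : D l = wlen v -> D y = enc v -> (wlen v < L)%N ->
  (D a <= A)%N -> (D (tprod (Var mu) a l y))%:R = star_prod R [:: D a] v.
Proof.
move=> hl hy ltv lea.
rewrite -[D _]/(nth 0%N t8 ((mu * (D tm * D tk + 1) + D a) * (D tL * D tF)
  + (D l * D tF + D y)))%N hl hy den_tF [D tm]e1 [D tL]/= [D tk]e3 e3 addn1.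
exact: t8_nth.
Qed.

Lemma den_tlag d a q : (D d <= k)%N -> (D a <= A)%N -> (D q <= k)%N ->
  (D (tlag (Var mu) d a q))%:R = lag R (D d) (D a) (D q).
Proof.
move=> led lea leq; rewrite -lag_den // /tlag den_Sum; congr _%:R.
by apply: eq_bigr => r _; rewrite /= e1 e3 !addn1.
Qed.

Lemma den_tval h i j y :
  D (tval (Var mu) h i j y) = nth 0%N s (vidx (D h) (D i) (D j) (D y)).
Proof.
rewrite -[D _]/(nth 0%N s ((((mu * (D tk + 1) + D h) * (D tn + 1) + D i)
  * (D tk + 1) + D j) * D tF + D y))%N den_tF [D tn]e0 [D tk]e3 !addn1.
by [].
Qed.

Lemma treduce_den h i j y l v : D l = wlen v -> D y = enc v -> (wlen v < L)%N ->
  (0 < bars v)%N -> (bars v <= k)%N ->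
  (forall q, (q < bars v)%N -> (nth 0%N s (vidx (D h) (D i) (D j) (enc (ins q v))))%:R
      = walk_sum col p (D h - 1) R (D i) (D j) (ins q v)) ->
  (D (treduce (Var mu) h i j y l))%:R = walk_sum col p (D h - 1) R (D i) (D j) (false :: v).
Proof.
move=> hl hy ltv v0 vk IH; rewrite /treduce (den_Let _ (den_tbars hl hy ltv)).
rewrite den_Sum natr_sum walk_sum_star //; apply: eq_bigr => q _.
have kA : (k <= A)%N by rewrite leq_pmull.
have leqv : (q <= bars v)%N by apply: ltnW.
rewrite den_Mul natrM den_tlag //; last by apply: leq_trans leqv vk.
  have ht : D (tins l y (Var q)) = enc (ins q v) by rewrite (den_tins hl hy).
  by rewrite den_tval ht IH.
exact: leq_trans vk kA.
Qed.

Lemma tstep_den h i j y l v : D l = wlen v -> D y = enc v -> ((wlen v).+1 < L)%N ->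
  (D i <= n)%N -> (D h <= k)%N -> (bars v <= k)%N ->
  (forall i' j' u, (i' < D i)%N -> (j' <= D j)%N -> wlen u = (wlen v).+2 ->
     (0 < bars u)%N ->
     (nth 0%N s (vidx (D h) i' j' (enc u)))%:R = walk_sum col p (D h - 1) R i' j' u) ->
  (D (tstep (Var mu) h i j y l))%:R = walk_sum col p (D h - 1) R (D i) (D j) (true :: v).
Proof.
move=> hl hy ltv lein lehk vk IH.
have ltv' : (wlen v < L)%N by apply: ltnW.
have kA : (k <= A)%N by rewrite leq_pmull.
rewrite /tstep (den_Let _ (den_tbars hl hy ltv')).
have [i0|i0] := posnP (D i); first by rewrite den_Ite i0 walk_sum0 /= mulnb.
rewrite den_Ite -lt0n i0 walk_sumS // den_Sum natr_sum; apply: eq_bigr => i' _.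
have hq : D (Get 3 (Op Add (Op Mul (Var i') (Op Add tn 1%N)) i)) = col i' (D i).
  by rewrite -[LHS]/(nth 0%N t3 (i' * (D tn + 1) + D i))%N [D tn]e0 addn1 h3.
rewrite (den_Let _ hq) den_Ite -[D (Op Eq _ _)]/(nat_of_bool (col i' (D i) == D tp)).
rewrite [D tp]e2 eqb0 negbK; case: ifP => _.
  case Ej: (D j) => [|j']; rewrite den_Ite Ej; first by [].
  rewrite -[LHS]/((D (tval (Var mu) h (Var i') (Op Defs.Sub j 1%N) y))%:R).
  rewrite den_tval hy -[D (Op _ _ _)]/(D j - 1)%N Ej subn1 /=.
  have -> : enc v = enc (true :: v) by rewrite /= add0n.
  by apply: (IH i' j' (true :: v)); rewrite ?Ej //=; lia.
rewrite den_Sum -[D (Op _ _ _)]/(D h - 1)%N natr_sum; apply: eq_bigr => c _.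
rewrite (@den_Let _ _ (col i' (D i) * (D h - 1) + c)%N) //; set a := (_ + c)%N.
have lea : (a <= A)%N.
  have hc := col_lt i' (D i); apply: (@leq_trans (m * (D h - 1))).
    by apply: ltnW; apply: pack_lt.
  by apply: leq_mul => //; apply: leq_trans lehk; apply: leq_subr.
rewrite den_Mul natrM (den_tprod hl hy) //; congr (_ * _).
rewrite den_Sum natr_sum; apply: eq_bigr => s1 _.
rewrite den_Sum natr_sum; apply: eq_bigr => s2 _.
have l1 : (s1 <= bars v)%N by apply: ltnW.
have l2 : (s2 <= bars v)%N by apply: ltnW.
have l1k := leq_trans l1 vk; have l2k := leq_trans l2 vk.
rewrite den_Mul den_Mul !natrM !den_tlag // den_tval; congr (_ * _).
have hw := wlen_ins l2.
have hi : D (tins l y (Var s2)) = enc (ins s2 v) by rewrite (den_tins hl hy).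
rewrite (@den_tins _ _ _ (ins s2 v)) ?bars_ins ?hw //; last first.
  by rewrite -[LHS]/(D l + 1)%N hl addn1.
apply: IH; [exact: ltn_ord|exact: leqnn|by rewrite wlen_ins ?bars_ins ?hw|].
by rewrite !bars_ins; apply: leq_ltn_trans (ltn_ord s1).
Qed.

End Eval.

Lemma t9_nth h i j u : (0 < h)%N -> (h <= k)%N -> (i <= n)%N -> (j <= k)%N ->
  wlen u = (2 * (k - h) + 2)%N -> (0 < bars u)%N ->
  (nth 0%N t9 (vidx h i j (enc u)))%:R = walk_sum col p (h - 1) R i j u.
Proof.
move=> h0 lehk; elim/ltn_ind: i j u => i IHi j u lein lejk.
move: {2}(enc u) (leqnn (enc u)) => y.
elim/ltn_ind: y u => y IHy u ley wu nu.
have FF := F_gt0.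
have ltyF : (enc u < F)%N by apply: enc_lt_F; rewrite wu; lia.
have [|s -> hs] := h9 (x := vidx h i j (enc u)).
  rewrite -[X in (_ < X)%N]/(12 * ((nth 0 t0 0 + nth 0 t0 1) * (nth 0 t0 0 + nth 0 t0
    1) * (nth 0 t0 0 + nth 0 t0 1))
    * ((nth 0 t0 3 + 1) * ((nth 0 t0 0 + 1) * ((nth 0 t0 3 + 1) * nth 0 t4 (2 * nth 0
        t0 3 + 3)))))%N.
  rewrite e0 e1 e3 t4F !addn1 /vidx; move: (12 * _)%N ltmu => MM ltmu'.
  by rewrite !mulnA !pack_lt.
cbv [walk_phase snd rcons].
have hM : den nv orc [:: t0; t1; t2; t3; t4; t5; t6; t7; t8; s] tM = M.
  by rewrite /= e0 e1.
set x := vidx h i j (enc u) in hs *.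
have lthk : (h < k.+1)%N by [].
rewrite (@den_Let s _ _ (enc u)); last first.
  rewrite -[LHS]/(x %% (den nv orc [:: t0; t1; t2; t3; t4; t5; t6; t7; t8; s] tF - 1).+1)%N.
  by rewrite den_tF subn1K // pack_mod.
rewrite (@den_Let s _ _ (((mu * k.+1 + h) * n.+1 + i) * k.+1 + j)%N); last first.
  rewrite -[LHS]/(x %/ den nv orc [:: t0; t1; t2; t3; t4; t5; t6; t7; t8; s] tF)%N.
  by rewrite den_tF pack_div.
set z1 := (_ + j)%N.
rewrite (@den_Let s _ _ j); last first.
  by rewrite -[LHS]/(z1 %% (nth 0%N t0 3).+1)%N e3 pack_mod.
rewrite (@den_Let s _ _ ((mu * k.+1 + h) * n.+1 + i)%N); last first.
  by rewrite -[LHS]/(z1 %/ (nth 0%N t0 3 + 1))%N e3 addn1 pack_div.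
set z2 := (_ + i)%N.
rewrite (@den_Let s _ _ i); last first.
  by rewrite -[LHS]/(z2 %% (nth 0%N t0 0).+1)%N e0 pack_mod.
rewrite (@den_Let s _ _ (mu * k.+1 + h)%N); last first.
  by rewrite -[LHS]/(z2 %/ (nth 0%N t0 0 + 1))%N e0 addn1 pack_div.
set z3 := (_ + h)%N.
rewrite (@den_Let s _ _ h); last first.
  by rewrite -[LHS]/(z3 %% (nth 0%N t0 3).+1)%N e3 pack_mod.
rewrite (@den_Let s _ _ mu); last first.
  rewrite -[LHS]/((z3 %/ (nth 0 t0 3 + 1)) %%
    (den nv orc [:: t0; t1; t2; t3; t4; t5; t6; t7; t8; s] tM - 1).+1)%N.
  by rewrite hM e3 addn1 pack_div // subn1K ?M_gt0 // modn_small.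
rewrite (@den_Let s _ _ (2 * (k - h))%N); last by rewrite -[LHS]/(2 * (nth 0 t0 3 -
  h))%N e3.
set l := (2 * (k - h))%N in wu *.
rewrite den_Rem natr_mod den_Ite.
rewrite -[den _ _ _ (Op Lt _ _)]/(nat_of_bool (enc u < nth 0 t4 (l + 1))%N).
have hl4 : nth 0%N t4 (l + 1) = fib l.+1 by rewrite t4_nth addn1 // /l; lia.
rewrite hl4 eqb0 negbK.
rewrite {}/x in hs *; case: u IHy ley wu nu ltyF hs => [|[] v] IHy ley wu nu ltyF hs.
- by [].
- have wv : wlen v = l by move: wu; rewrite /=; lia.
  have nv2 := bars_wlen v; rewrite (_ : (_ < _)%N = true); last first.
    by rewrite -wv; exact: enc_lt.
  apply: (@tstep_den s (Var h) (Var i) (Var j) (Var (enc (true :: v))) (Var l) v) => //.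
  + by rewrite wv /l; lia.
  + by move: nv2; rewrite wv /l; lia.
  + move=> i' j' u' lti lej wu' nu'.
    have lej' : (j' <= k)%N by apply: leq_trans lej lejk.
    have wu2 : wlen u' = (l + 2)%N by rewrite wu' wv addn2.
    rewrite hs; last first.
      by apply: vidx_i => //; apply: enc_lt_F; rewrite wu2 /l; lia.
    by apply: IHi => //; apply: leq_trans (ltnW lti) lein.
- have wv : wlen v = l.+1 by move: wu; rewrite /=; lia.
  have nv2 := bars_wlen v; rewrite (_ : (_ < _)%N = false); last first.
    by rewrite /= wv ltnNge leq_addr.
  apply: (@treduce_den s (Var h) (Var i) (Var j) _ _ v) => //.
  + by rewrite -[LHS]/(l + 1)%N addn1 wv.
  + rewrite -[LHS]/(enc (false :: v) - nth 0 t4 (l + 1))%N hl4.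
    by rewrite -[enc (false :: v)]/(fib (wlen v) + enc v)%N wv addKn.
  + by rewrite wv /l; lia.
  + by move: nv2; rewrite wv /l; lia.
  + move=> q ltq; have hlt := enc_ins ltq; rewrite hs; last exact: vidx_y.
    apply: (IHy (enc (ins q v))) => //; first by apply: leq_trans hlt ley.
      by rewrite wlen_ins ?wv ?addn2 // ltnW.
    by rewrite bars_ins.
Qed.

End Mod.


Section Answer.
Import GRing.Theory.
Local Open Scope ring_scope.
Hypothesis m0 : (0 < m)%N.
Variable col : nat -> nat -> nat.
Hypothesis col_lt : forall x y, (col x y < m)%N.
Hypothesis h3 : forall x y, (x < y)%N -> (y <= n)%N -> nth 0%N t3 (x * n.+1 + y) = col x y.
Hypothesis h9 : tabspec [:: t0; t1; t2; t3; t4; t5; t6; t7; t8] walk_phase t9.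

Hypothesis lekn : (k <= n)%N.

Lemma t9_total mu h : (mu < M)%N -> (0 < h)%N -> (h <= k)%N ->
  (mu.+1 %| nth 0 t9 (vidx mu h n h 0))%N = (mu.+1 %| total col p (h - 1) n h (k - h))%N.
Proof.
(* Modulus 1 is treated apart, since ['Z_1] is not a ring in which 1 vanishes. *)
move=> ltmu h0 lehk; case: mu ltmu => [|mu] ltmu; first by rewrite !dvd1n.
have p1 : (1 < mu.+2)%N by [].
have Z0 x : (x%:R == 0 :> 'Z_mu.+2) = (mu.+2 %| x)%N.
  by rewrite -val_eqE /= val_Zp_nat // /dvdn.
have hmu : mu.+2%:R = 0 :> 'Z_mu.+2 by apply/eqP; rewrite Z0.
rewrite -!Z0; congr (_ == _).
have := t9_nth hmu ltmu m0 col_lt h3 h9 (u := nseq (k - h).+1 true) h0 lehk (leqnn n) lehk.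
rewrite enc_nseq wlen_nseq bars_nseq => ->; last 2 first; [by lia|by []|].
by rewrite walk_sum_int -totalE -pmulrn.
Qed.

Lemma den_tansE : den nv orc [:: t0; t1; t2; t3; t4; t5; t6; t7; t8; t9] tans =
  (0 < \sum_(mu < M) \sum_(s < k)
         nth 0 t9 (vidx mu (s + 1) n (s + 1) 0) %% mu.+1)%N.
Proof.
rewrite /= e0 e1 e3 t4F; congr (nat_of_bool (0 < _)%N); apply: eq_bigr => mu _.
by apply: eq_bigr => s _; rewrite /vidx !addn1.
Qed.

Lemma den_tans :
  (0 < \sum_(mu < M) \sum_(s < k) nth 0 t9 (vidx mu (s + 1) n (s + 1) 0) %% mu.+1)%N <->
  exists h, (0 < h <= k)%N /\ (0 < total col p (h - 1) n h (k - h))%N.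
Proof.
rewrite lt0n sum_nat_eq0 negb_forall; split.
- move=> /existsP[mu]; rewrite negb_imply /= sum_nat_eq0 negb_forall => /existsP[q].
  rewrite negb_imply /= -/(dvdn _ _) t9_total ?addn1 // => hd.
  exists q.+1; split; first exact: ltn_ord.
  by rewrite lt0n; apply: contraNneq hd => ->.
- move=> [h [/andP[h0 lehk] tp]].
  (* The exponent comes from [total_lt], and the modulus found is at most twice it, which is
     [tM]. *)
  have [|mu ltmu hd] := small_nondivisor tp (h := 6 * (n + m) ^ 3).
    by apply: (@total_lt _ _ _ m k) => //; lia.
  have ltM : (mu < M)%N by apply: leq_trans ltmu _; rewrite !expnS expn0; lia.
  apply/existsP; exists (Ordinal ltM); rewrite negb_imply /= sum_nat_eq0 negb_forall.
  have lth : (h.-1 < k)%N by lia.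
  apply/existsP; exists (Ordinal lth); rewrite negb_imply /= -/(dvdn _ _) addn1 prednK //.
  by rewrite t9_total.
Qed.
End Answer.

End Tables.

(** * The path order and the winners of intervals *)

Section PathTables.
Variables (I : wgm_instance) (eta : {set 'I_(nvoters I)} -> 'I_(ncands I)).
Notation n := (nvoters I).
Notation m := (ncands I).
Notation orc := (eta_oracle eta).
Variables (t0 t1 t2 t3 : seq nat).
Hypotheses (e0 : nth 0 t0 0 = n) (e1 : nth 0 t0 1 = m).
Hypothesis hedge : forall u v : 'I_n, nth 0 t0 (4 + (u * n + v)) = edge u v.
Hypothesis h1 : tabspec n orc [:: t0] order_phase t1.
Hypothesis h2 : tabspec n orc [:: t0; t1] interval_phase t2.
Hypothesis h3 : tabspec n orc [:: t0; t1; t2] winner_phase t3.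
Hypothesis sz2 : size t2 = (n + 1) * (n + 1) * n.

Definition path_order (s : seq 'I_n) :=
  [/\ uniq s, forall v, v \in s &
      forall u v, edge u v = (index v s == (index u s).+1)
                          || (index u s == (index v s).+1)].

Lemma idx_rev s w : path_order s -> idx (rev s) w = n - (idx s w).+1.
Proof.
move=> [us sall sE]; have sz := size_s us sall; have lt := idx_lt us sall w.
have e : nth w (rev s) (n - (idx s w).+1) = w.
  rewrite nth_rev sz; last by lia.
  by rewrite (_ : n - _ = idx s w) ?nth_index //; lia.
by rewrite -{1}e /idx index_uniq ?rev_uniq // size_rev sz; lia.
Qed.

Lemma path_order_rev s : path_order s -> path_order (rev s).
Proof.
move=> hs; have [us sall sE] := hs; split=> [|v|u v]; rewrite ?rev_uniq ?mem_rev // sE.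
rewrite -!/(idx _ _) !idx_rev //.
have := idx_lt us sall u; have := idx_lt us sall v; lia.
Qed.

Lemma deg_end s v : path_order s -> 0 < n ->
  (#|[pred z | edge v z]| < 2) = (idx s v == 0) || ((idx s v).+1 == n).
Proof.
move=> [us sall sE] n0; have ltv := idx_lt us sall v.
apply/idP/idP => [|h].
  apply: contraLR; rewrite negb_or => /andP[v0 vn]; rewrite -leqNgt.
  have [a ha] := idx_surj us sall n0 (x := (idx s v).-1) ltac:(lia).
  have [b hb] := idx_surj us sall n0 (x := (idx s v).+1) ltac:(lia).
  apply/card_gt1P; exists a, b; rewrite !inE !sE -!/(idx _ _) ha hb; split; try lia.
  by apply: contra_neq v0 => e; move: ha; rewrite e hb; lia.
rewrite ltnS; apply/card_le1_eqP => a b; rewrite !inE !sE -!/(idx _ _) => ha hb.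
have := idx_lt us sall a; have := idx_lt us sall b => lb la.
by apply: (idx_inj sall); lia.
Qed.

Lemma deg_den (v : 'I_n) tabs :
  den n orc (t0 :: tabs) (tdeg (Var v)) = #|[pred z | edge v z]|.
Proof.
rewrite /= e0 -sum1_card [RHS]big_mkcond; apply: eq_bigr => z _.
by rewrite inE hedge; case: (edge _ _).
Qed.

Lemma sum_lt a b : a <= b -> \sum_(i < b) (i < a) = a.
Proof.
move=> le; rewrite (eq_bigr (fun i : 'I_b => if i < a then 1 else 0)); last by move=>
  i _; case: (_ < _).
by rewrite -big_mkcond -(big_ord_widen b (fun=> 1)) // sum_nat_const card_ord muln1.
Qed.

Lemma start_den tabs s : path_order s -> 0 < n ->
  exists2 v : 'I_n, den n orc (t0 :: tabs) tstart = v &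
    (idx s v == 0) || ((idx s v).+1 == n).
Proof.
move=> hs n0; have [us sall sE] := hs.
have [v0 hv0] := idx_surj us sall n0 n0.
have ex : exists x, (x < n) && [exists v : 'I_n, (v == x :> nat) && (#|[pred z | edge
  v z]| < 2)].
  exists v0; rewrite ltn_ord /=; apply/existsP; exists v0.
  by rewrite eqxx (deg_end _ hs n0) hv0.
case: (ex_minnP ex) => x /andP[ltx /existsP[v /andP[/eqP ev dv]]] hmin.
exists v; last by rewrite -deg_end.
rewrite ev -[RHS](sum_lt (ltnW ltx)).
rewrite -[LHS]/(\sum_(y < nth 0 t0 0) (\sum_(u < y + 1)
  (den n orc (t0 :: tabs) (tdeg (Var u)) < 2) == 0)) e0.
apply: eq_bigr => y _; congr nat_of_bool; rewrite sum_nat_eq0.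
apply/forallP/idP => [h|lty u].
  rewrite ltnNge; apply/negP => lexy.
  have hx : x < y + 1 by rewrite addn1 ltnS.
  by have := h (Ordinal hx); rewrite [nat_of_ord _]/= -ev deg_den dv.
apply/implyP => _; rewrite eqb0; apply/negP => hd.
have ltu : u < n by apply: leq_trans (ltn_ord u) _; rewrite addn1 (leq_trans _ (ltn_ord y)).
have := hmin u; rewrite ltu /=.
have -> : [exists v1 : 'I_n, (v1 == u :> nat) && (#|[pred z | edge v1 z]| < 2)].
  by apply/existsP; exists (Ordinal ltu); rewrite eqxx /= -(deg_den _ tabs).
by have := ltn_ord u; lia.
Qed.

Lemma next_den s t x : path_order s -> x.+1 < n ->
  (forall i, i <= x -> exists2 v : 'I_n, idx s v = i & nth 0 t i = v) ->
  exists2 v : 'I_n, idx s v = x.+1 & den n orc [:: t0; t] (tnext (Var x.+1)) = v.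
Proof.
move=> hs ltx ht; have [us sall sE] := hs.
have n0 : 0 < n by apply: leq_ltn_trans ltx.
have [w hw] := idx_surj us sall n0 ltx.
have [v hv ev] := ht x (leqnn x); have [v' hv' ev'] := ht x.-1 (leq_pred x).
exists w => //; rewrite -[LHS]/(\sum_(z < nth 0 t0 0) z * (nth 0 t0 (4 + (nth 0 t
  (x.+1 - 1) * nth 0 t0 0 + z))
  * (1 - (z == nth 0 t (x.+1 - 2) :> nat)))) e0 subn1 /= ev.
have -> : x.+1 - 2 = x.-1 by lia.
rewrite ev' (bigD1 w) //= big1 => [|z zw].
  rewrite hedge sE -!/(idx _ _) hw hv eqxx /= (_ : (_ == _) = false) ?addn0 ?muln1 //.
  by apply/negbTE/eqP => e; have := hv'; rewrite -(ord_inj e) hw; lia.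
rewrite hedge sE -!/(idx _ _) hv.
have zx : idx s z != x.+1 by apply: contraNneq zw => e; apply/eqP/(idx_inj sall);
  rewrite e hw.
rewrite (negPf zx) /=; case: (eqVneq x (idx s z).+1) => [ex|_]; last by rewrite muln0.
have -> : z = v' by apply: (idx_inj sall); rewrite hv' ex.
by rewrite eqxx /= muln0.
Qed.

Lemma t1_nth : is_path_graph I -> exists2 s, path_order s &
  forall i, i < n -> exists2 v : 'I_n, idx s v = i & nth 0 t1 i = v.
Proof.
move=> [n0 [s0 [us sall sE]]]; have hs0 : path_order s0 by [].
have c0 : nth 0 t1 0 < n /\ exists2 s, path_order s & forall v : 'I_n, nth 0 t1 0 = v
  -> idx s v = 0.
  have [|s -> hs] := h1 (x := 0); first by rewrite /= e0.
  have [v hv he] := start_den [:: s] hs0 n0.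
  rewrite -[den _ _ _ _]/(den n orc [:: t0; s] tstart %% (nth 0 t0 0).+1) hv e0
    modn_small; last exact: leqW.
  split=> //; case/orP: he => /eqP he.
    by exists s0 => // w /ord_inj <-.
  exists (rev s0); first exact: path_order_rev.
  by move=> w /ord_inj <-; rewrite idx_rev // he subnn.
have [lt0 [s hs hs0']] := c0; exists s => //.
elim/ltn_ind => -[|i] IH lti; first by exists (Ordinal lt0) => //; apply: hs0'.
have [|t -> ht] := h1 (x := i.+1); first by rewrite /= e0.
have [|v hv1 hv2] := next_den (t := t) hs lti.
  move=> j lej; have [v v1 v2] := IH j lej (leq_ltn_trans lej (ltnW lti)).
  by exists v => //; rewrite ht.
exists v => //.
rewrite -[LHS]/(den n orc [:: t0; t] (tnext (Var i.+1)) %% (nth 0 t0 0).+1) hv2 e0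
  modn_small //.
exact: leqW.
Qed.

Lemma t3_nth : is_path_graph I -> exists2 s, path_order s &
  forall x y, x < y -> y <= n -> nth 0 t3 (x * n.+1 + y) = icol s eta x y.
Proof.
move=> hI; have [s hs ht1] := t1_nth hI; exists s => // x y ltxy leyn.
have [us sall sE] := hs; have n0 : 0 < n := hI.1.
have lex : x < n.+1 by lia.
have ley : y < n.+1 by [].
set z := x * n.+1 + y.
have ltz : z < n.+1 * n.+1 by rewrite pack_lt.
have [|s3 -> _] := h3 (x := z); first by rewrite /= e0 !addn1.
rewrite -[LHS]/((if size t2 < z * nth 0 t0 0 + n then 0 else
   orc (fun i => nth 0 t2 (z * nth 0 t0 0 + i))) %% (nth 0 t0 1).+1) e0 e1 sz2 !addn1.
rewrite ifF; last by apply/negbTE; rewrite -leqNgt -mulSnr leq_mul.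
rewrite modn_small; last by apply/leqW/ltn_ord.
rewrite /eta_oracle /icol; congr (nat_of_ord (eta _)); apply/setP => v; rewrite !inE.
have [|s2 -> _] := h2 (x := z * n + v); first by rewrite /= e0 !addn1 pack_lt.
rewrite /= e0 !addn1 subn1K // pack_mod // pack_div // pack_mod // pack_div //.
have ltv := idx_lt us sall v.
rewrite (bigD1 (Ordinal ltv)) //= big1 => [|l lv].
  have [w hw ->] := ht1 _ ltv; rewrite (idx_inj sall hw) eqxx addn0 muln1 addn1 ltnS mulnb.
  by rewrite modn_small; case: (_ && _).
have [w hw ->] := ht1 l (ltn_ord l); rewrite (_ : (_ == _) = false) ?muln0 //.
apply/negbTE; apply: contraNneq lv => /ord_inj e; apply/eqP/val_inj => /=.
by rewrite -e hw.
Qed.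

End PathTables.

(** * Correctness and running time *)

(** If n < k, register 0 keeps its initial 0, the correct answer since districts are nonempty.
    Otherwise k <= n + m, so k may count as B. Register 1 becomes the length of table 0, and free
    memory starts after the whole input. *)
Definition prelude (c : cmd) : cmd :=
  Seq (Set_ regn (Fetch (Const 0)))
  (If (Bin Lt (Reg regn) (Fetch (Const 3))) Skip
    (Seq (Set_ 1 (Bin Add (Const 4) (Bin Mul (Reg regn) (Reg regn))))
    (Seq (Set_ regf (Bin Add (Reg 1) (Bin Mul (Reg regn) (Fetch (Const 1)))))
      c))).

Definition wgm_prog : cmd :=
  prelude (phases 1 all_phases (Seq (compile tans reg0) (Set_ 0 (Reg reg0)))).

Lemma time_bound U B x y : 0 < U -> 1 < B ->
  21 + (U * B ^ x + (B ^ y + 2)) <= U * B ^ (x + y + 5).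
Proof.
move=> U0 B2; apply: (@leq_trans (U * (B ^ (x + y) * 2 ^ 5))); last first.
  by apply: leq_mul => //; rewrite (expnD B (x + y)); apply: leq_mul => //; exact: pow2_le.
have hx : 0 < B ^ x by rewrite expn_gt0 ltnW.
have hy : 0 < B ^ y by rewrite expn_gt0 ltnW.
rewrite expnD !mulnA; have hz : 0 < U * B ^ x by rewrite muln_gt0 U0.
move: (U * B ^ x) (B ^ y) hz hy => z t hz hy; nia.
Qed.

Lemma nth_allpairs (S T : Type) (U : Type) (x0 : U) (u0 : S) (v0 : T)
    (f : S -> T -> U) (s : seq S) (t : seq T) i j :
  i < size s -> j < size t ->
  nth x0 [seq f u v | u <- s, v <- t] (i * size t + j) = f (nth u0 s i) (nth v0 t j).
Proof.
move=> + ltj; elim: s i => // u s IH [|i] lti; rewrite /= nth_cat size_map.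
  by rewrite mul0n add0n ltj (nth_map v0).
by rewrite mulSn -addnA ltnNge leq_addr /= addKn IH.
Qed.

Section Run.
Variables (I : wgm_instance) (eta : {set 'I_(nvoters I)} -> 'I_(ncands I)).
Notation n := (nvoters I).
Notation m := (ncands I).
Notation k := (ndist I).
Notation p := (nat_of_ord (pref I)).
Notation orc := (eta_oracle eta).
Notation B := (n + m).
Notation U := (fib (2 * k + 4)).

Definition input := take (4 + n * n) (encode I).

Arguments input : simpl never.

Lemma encode_edge (u v : 'I_n) : nth 0 (encode I) (4 + (u * n + v)) = edge u v.
Proof.
have lt : u * n + v < n * n by rewrite pack_lt.
have sz : size (enum 'I_n) = n by rewrite size_enum_ord.
rewrite -[LHS]/(nth 0 ([seq nat_of_bool (edge u v) | u <- enum 'I_n, v <- enum 'I_n]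
  ++ [seq weight v q | v <- enum 'I_n, q <- enum 'I_m]) (u * n + v)).
rewrite nth_cat size_allpairs sz lt.
have := @nth_allpairs _ _ _ 0 u v (fun u v => nat_of_bool (edge u v)) (enum 'I_n)
  (enum 'I_n) u v.
by rewrite sz !nth_ord_enum => ->.
Qed.

Lemma size_input : size input = 4 + n * n.
Proof.
rewrite size_takel // /encode !size_cat /= !size_allpairs !size_enum_ord.
by rewrite leq_add2l leq_addr.
Qed.

Lemma nth_input i : i < 4 + n * n -> nth 0 input i = nth 0 (encode I) i.
Proof. by move=> lti; rewrite /input nth_take. Qed.

Lemma input_edge (u v : 'I_n) : nth 0 input (4 + (u * n + v)) = edge u v.
Proof. by rewrite nth_input ?encode_edge // ltn_add2l pack_lt. Qed.

Lemma m_gt0 : 0 < m.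
Proof. exact: leq_ltn_trans (ltn_ord (pref I)). Qed.

Lemma input_le i : 0 < n -> k <= n -> nth 0 input i <= B.
Proof.
move=> n0 lekn; case: (ltnP i (4 + n * n)) => [lti|le]; last first.
  by rewrite nth_default ?size_input.
case: (ltnP i 4) => [lt4|le4].
  have hp := ltn_ord (pref I).
  rewrite nth_input //; case: i lt4 {lti} => [|[|[|[|//]]]] _ /=; lia.
have ltn2 : i - 4 < n * n by lia.
have lt1 : (i - 4) %/ n < n by rewrite ltn_divLR.
have lt2 : (i - 4) %% n < n by rewrite ltn_mod.
have := input_edge (Ordinal lt1) (Ordinal lt2); rewrite -[X in nth 0 input X]/(4 +
  ((i - 4) %/ n * n + (i - 4) %% n)).
rewrite -divn_eq subnKC // => ->.
by case: (edge _ _); lia.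
Qed.

Lemma orc_le f : orc f <= B.
Proof. by apply: leq_trans (ltnW (ltn_ord _)) (leq_addl _ _). Qed.

Lemma orc_ext f g : (forall i, i < n -> f i = g i) -> orc f = orc g.
Proof.
move=> h; rewrite /eta_oracle; congr (nat_of_ord (eta _)).
by apply/setP => v; rewrite !inE h.
Qed.

Lemma prelude_runs w c T Q : 0 < n -> k <= n -> B ^ 4 < 2 ^ w ->
  (forall s, tables_stored w n [:: input] s -> tables_below [:: input] s -> regs s
    regf < B ^ 4 ->
    runs w orc c s T Q) ->
  runs w orc (prelude c) (init I) (21 + T) Q.
Proof.
move=> n0 lekn w3 hc; have m0 := m_gt0.
have B4 : 16 <= B ^ 4 by rewrite (@leq_exp2r 2 B 4) //; lia.
have hF : 4 + n * n + n * m < B ^ 4.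
  have B2 : 1 < B by lia.
  have := leq_mul B2 B2; rewrite !expnS expn0 muln1; nia.
have lt5 : 4 + n * n + n * m < 2 ^ w := ltn_trans hF w3.
have y5 : 4 + n * n < 2 ^ w := leq_ltn_trans (leq_addr _ _) lt5.
have lt4 : 4 < 2 ^ w := leq_ltn_trans (leq_addr _ _) y5.
have z1 : 1 %% 2 ^ w = 1 by rewrite modn_small // (leq_ltn_trans _ lt4).
have z3 : 3 %% 2 ^ w = 3 by rewrite modn_small // (leq_ltn_trans _ lt4).
have z4 : 4 %% 2 ^ w = 4 by rewrite modn_small.
have y1 : n * n %% 2 ^ w = n * n.
  by rewrite modn_small // (leq_ltn_trans (leq_addl 4 _) y5).
have y2 : n * m %% 2 ^ w = n * m.
  by rewrite modn_small // (leq_ltn_trans (leq_addl (4 + n * n) _) lt5).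
have y3 : (4 + n * n) %% 2 ^ w = 4 + n * n by rewrite modn_small.
have y4 : (4 + n * n + n * m) %% 2 ^ w = 4 + n * n + n * m by rewrite modn_small.
apply: (runs_le (T := 3 + (5 + (6 + (7 + T))))); last by rewrite !addnA.
apply: (runs_seq (P := fun s => [/\ regs s regn = n, forall r, r != regn -> regs s r = 0
    & smem s = nth 0 (encode I)])).
  apply: runs_set; split; [by rewrite /= upd_same mod0n| |by []].
  by move=> r ne; rewrite /= upd_other.
move=> s1 [a1 a2 a3]; apply: (runs_if (a := Bin Lt _ _)).
rewrite (_ : eval _ _ _ = 0); last by rewrite /= a1 a3 z3 ltnNge [_ <= _]lekn mod0n.
rewrite eqxx /=.
apply: (runs_seq (P := fun s => [/\ regs s regn = n, regs s 1 = 4 + n * n,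
    forall r, r != regn -> r != 1 -> regs s r = 0 & smem s = nth 0 (encode I)])).
  apply: runs_set; split; [by rewrite /= upd_other ?a1| | |by []].
    by rewrite /= upd_same a1 z4 y1 y3.
  by move=> r ne ne1; rewrite /= upd_other ?a2.
move=> s2 [b1 b2 b3 b4].
apply: (runs_seq (P := fun s => [/\ regs s regn = n, regs s 1 = 4 + n * n,
    regs s regf = 4 + n * n + n * m,
    forall r, r < regn -> r != 1 -> regs s r = 0 & smem s = nth 0 (encode I)])).
  apply: runs_set; split; [by rewrite /= upd_other ?b1|by rewrite /= upd_other ?b2| |
    |by []].
    by rewrite /= upd_same b1 b2 b4 z1 -[nth 0 (encode I) 1]/m y2 y4.
  by move=> r lt ne1; rewrite /= upd_other ?b3 // neq_ltn ?lt // (leq_trans lt).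
move=> s3 [c1 c2 c3 c4 c5]; have c40 : regs s3 (2 * 0) = 0 by apply: c4.
apply: hc; last by rewrite c3.
  split; first exact: c1.
  move=> q ltq; have lt2 : (2 * q).+1 < regn by clear -ltq; unfold regn, ntabs in *; lia.
  case: q ltq lt2 => [|q] ltq lt2.
    rewrite -[nth _ _ 0]/input size_input c40 add0n; split; [exact: c2|exact: y5|].
    by move=> i lti; rewrite add0n c5 nth_input.
  rewrite (nth_default [::] (s := [:: input])); last by [].
  have c4q : regs s3 (2 * q.+1) = 0 by rewrite c4 ?(ltnW lt2) // mulnS.
  split; [by rewrite c4 // mulnS|by rewrite c4q expn_gt0|by []].
case=> [_|//]; rewrite -[nth _ _ 0]/input size_input c40 c3 add0n.
exact: leq_addr.
Qed.

Lemma prelude_no w c : n < k -> 3 < 2 ^ w ->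
  runs w orc (prelude c) (init I) 9 (fun s => regs s 0 = 0).
Proof.
move=> ltnk w3; apply: (runs_le (T := 3 + (5 + 1))) => //.
have z3 : 3 %% 2 ^ w = 3 by rewrite modn_small.
apply: (runs_seq (P := fun s => [/\ regs s regn = n, regs s 0 = 0
    & smem s = nth 0 (encode I)])).
  by apply: runs_set; split; [rewrite /= upd_same mod0n|rewrite /= upd_other|].
move=> s1 [a1 a2 a3]; apply: (runs_if (a := Bin Lt _ _)).
have -> : eval w s1 (Bin Lt (Reg regn) (Fetch (Const 3))) = 1.
  rewrite /= a1 a3 z3 -[nth 0 (encode I) 3]/k ltnk modn_small //.
  exact: leq_ltn_trans w3.
by exists 1, s1; split; [exact: ExecSkip| |].
Qed.

Let t1 := ftab n orc [:: input] order_phase.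
Let t2 := ftab n orc [:: input; t1] interval_phase.
Let t3 := ftab n orc [:: input; t1; t2] winner_phase.
Let t4 := ftab n orc [:: input; t1; t2; t3] fib_phase.
Let t5 := ftab n orc [:: input; t1; t2; t3; t4] binomial_phase.
Let t6 := ftab n orc [:: input; t1; t2; t3; t4; t5] bars_phase.
Let t7 := ftab n orc [:: input; t1; t2; t3; t4; t5; t6] insert_phase.
Let t8 := ftab n orc [:: input; t1; t2; t3; t4; t5; t6; t7] product_phase.
Let t9 := ftab n orc [:: input; t1; t2; t3; t4; t5; t6; t7; t8] walk_phase.

Lemma fillsS tabs ph ps :
  fills n orc tabs (ph :: ps) = fills n orc (rcons tabs (ftab n orc tabs ph)) ps.
Proof. by case: ph. Qed.

Lemma fills_all_phases : fills n orc [:: input] all_phases =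
  [:: input; t1; t2; t3; t4; t5; t6; t7; t8; t9].
Proof.
rewrite /all_phases fillsS -/t1 [rcons _ _]/= fillsS -/t2 [rcons _ _]/= fillsS -/t3.
rewrite [rcons _ _]/= fillsS -/t4 [rcons _ _]/= fillsS -/t5 [rcons _ _]/=.
rewrite fillsS -/t6 [rcons _ _]/= fillsS -/t7 [rcons _ _]/= fillsS -/t8.
by rewrite [rcons _ _]/= fillsS -/t9.
Qed.

Lemma e0 : nth 0 input 0 = n. Proof. by rewrite nth_input. Qed.
Lemma e1 : nth 0 input 1 = m. Proof. by rewrite nth_input. Qed.
Lemma e2 : nth 0 input 2 = p. Proof. by rewrite nth_input. Qed.
Lemma e3 : nth 0 input 3 = k. Proof. by rewrite nth_input. Qed.

Lemma t4_le x : nth 0 t4 x <= U.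
Proof.
case: (ltnP x (2 * k + 4)) => [lt|le]; last first.
  by rewrite nth_default // /t4 /ftab size_fill.
have h4 : tabspec n orc [:: input; t1; t2; t3] fib_phase t4 := @tabspec_ftab _ _ _ _.
by rewrite (t4_nth e3 h4) // leq_fib // ltnW.
Qed.

Lemma answerP : is_path_graph I -> k <= n ->
  den n orc [:: input; t1; t2; t3; t4; t5; t6; t7; t8; t9] tans = wgm_yes eta.
Proof.
move=> hI lekn; have n0 := hI.1; have k0 := ndist_gt0 I.
have sz2 : size t2 = (n + 1) * (n + 1) * n by rewrite /t2 /ftab size_fill.
have h1 : tabspec n orc [:: input] order_phase t1 := @tabspec_ftab _ _ _ _.
have h2 : tabspec n orc [:: input; t1] interval_phase t2 := @tabspec_ftab _ _ _ _.
have h3 : tabspec n orc [:: input; t1; t2] winner_phase t3 := @tabspec_ftab _ _ _ _.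
have h4 : tabspec n orc [:: input; t1; t2; t3] fib_phase t4 := @tabspec_ftab _ _ _ _.
have h5 : tabspec n orc [:: input; t1; t2; t3; t4] binomial_phase t5 := @tabspec_ftab
  _ _ _ _.
have h6 : tabspec n orc [:: input; t1; t2; t3; t4; t5] bars_phase t6 := @tabspec_ftab
  _ _ _ _.
have h7 : tabspec n orc [:: input; t1; t2; t3; t4; t5; t6] insert_phase t7 :=
  @tabspec_ftab _ _ _ _.
have h8 : tabspec n orc [:: input; t1; t2; t3; t4; t5; t6; t7] product_phase t8 :=
  @tabspec_ftab _ _ _ _.
have h9 : tabspec n orc [:: input; t1; t2; t3; t4; t5; t6; t7; t8] walk_phase t9 :=
  @tabspec_ftab _ _ _ _.
have [s [us sall sE] hcol] := t3_nth e0 e1 input_edge h1 h2 h3 sz2 hI.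
have hc x y : icol s eta x y < m by apply: ltn_ord.
have hd := den_tans e0 e1 e2 e3 n0 k0 h4 h5 h6 h7 h8 m_gt0 hc hcol h9 lekn.
have hy := wgm_yesP eta us sall sE n0.
rewrite (den_tansE t5 t6 t7 t8 t9 e0 e1 e2 e3 n0 k0 h4).
congr nat_of_bool; apply/idP/idP => [/hd [h [hk /total_gt0 /uniq_wordP hw]]|/hy [h
  [hk hw]]].
  by apply/hy; exists h; split=> //; rewrite -subn1.
by apply/hd; exists h; split=> //; apply/total_gt0/uniq_wordP; rewrite subn1.
Qed.

Lemma too_many : n < k -> wgm_yes eta = false.
Proof.
move=> ltnk; apply/negbTE/existsP => -[P /and4P[hP /eqP cP _ _]].
move: ltnk; rewrite -cP ltnNge => /negP[]; have hc := card_partition hP.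
rewrite cardsT card_ord in hc; apply: (@leq_trans (\sum_(A in P) #|A|)).
  rewrite -sum1_card; apply: leq_sum => A AP.
  by rewrite card_gt0 (partition_neq0 hP AP).
by rewrite -hc.
Qed.

Lemma prog_runs w E ea : bounded_phases table_classes 1 all_phases E -> bounded_term
  table_classes [::] tans tans (false, 0) ea ->
  is_path_graph I -> k <= n -> U * B ^ (E + ea + 4) < 2 ^ w ->
  runs w orc wgm_prog (init I) (U * B ^ (E + ea + 5))
    (fun s => regs s 0 = wgm_yes eta).
Proof.
move=> hE hea hI lekn hw; have n0 := hI.1.
have B2 : 1 < B by have := m_gt0; lia.
have U0 : 0 < U by rewrite addn4 fib_gt0.
have nB : n <= B by rewrite leq_addr.
have hT : tables_le table_classes B U [:: input; t1; t2; t3; t4; t5; t6; t7; t8; t9].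
  rewrite -fills_all_phases; apply: (fills_tables_le B2 U0 orc_le hE) => //.
    move=> q x; case: q => [|q] /=; last by rewrite nth_nil; case: q x => [|q] x;
      rewrite nth_nil.
    by rewrite /class_bound /= mul1n expn1 input_le.
  by move=> x; rewrite fills_all_phases /class_bound /= expn0 muln1 t4_le.
have mono x : x <= E + ea + 4 -> U * B ^ x < 2 ^ w.
  by move=> le; apply: leq_ltn_trans hw; apply: leq_mul => //; rewrite leq_pexp2l // ltnW.
apply: runs_le (time_bound E ea U0 B2).
apply: prelude_runs => // [|s1 i1 f1 r1].
  by apply: leq_ltn_trans (mono 4 _); rewrite ?leq_pmull ?leq_addl.
rewrite -fills_all_phases in hT.
rewrite -[1]/(size [:: input]).
apply: (phases_runs B2 U0 nB orc_le orc_ext hE (e := 4)) => //.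
- by apply: leq_trans (ltnW r1) (leq_pmull _ U0).
- by apply: mono; rewrite addnC leq_add2r leq_addr.
move=> s4 i4; have G4 : env_stored B U [::] s4 reg0 by [].
have hw' : U * B ^ ea < 2 ^ w by apply: mono; rewrite -addnA addnCA leq_addr.
apply: (runs_seq (compile_runs B2 U0 nB orc_le orc_ext hT hea hw' (leqnn _) i4 G4)).
move=> s5 [d1 _ _]; apply: runs_set.
by rewrite /= upd_same d1 fills_all_phases answerP.
Qed.

End Run.

Section Main.
Import GRing.Theory Num.Theory.
Local Open Scope ring_scope.

Lemma lit_ge1 : 1 <= 2.619%Q :> rat.
Proof. by rewrite litE; lra. Qed.

Lemma work_bound (x : rat) (k B e : nat) : (1 < B)%N -> 0 <= x ->
  (fib (2 * k + 4))%:R <= x ^+ k * 8%:R ->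
  (fib (2 * k + 4) * B ^ e)%:R <= x ^+ k * B%:R ^+ (e + 3).
Proof.
move=> B2 x0 h; rewrite natrM -natrX (addnC e) (expnD B 3) natrM mulrA.
apply: ler_pM; rewrite ?ler0n //.
apply: (Order.POrderTheory.le_trans h); apply: ler_wpM2l; first exact: exprn_ge0.
by rewrite ler_nat (@leq_exp2r 2 B 3).
Qed.

End Main.

Theorem theorem2 :
  exists (prog : cmd) (c : nat),
  forall (I : wgm_instance) (eta : {set 'I_(nvoters I)} -> 'I_(ncands I)),
  is_path_graph I -> tie_breaking eta ->
  forall w : nat,
  (* words hold the input numbers and addresses up to the time bound *)
  all (fun x => x < 2 ^ w) (encode I) ->
  (2.619%Q ^+ ndist I * (nvoters I + ncands I)%:R ^+ c <= (2 ^ w)%:R :> rat)%R ->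
  exists (t : nat) (s : state),
    [/\ exec w (eta_oracle eta) prog (init I) t s,
        (t%:R <= 2.619%Q ^+ ndist I * (nvoters I + ncands I)%:R ^+ c :> rat)%R &
        regs s 0 = wgm_yes eta].
Proof.
have [E hE] := bounded_all_phases; have [ea hea] := bounded_tans.
(* Five above [E + ea] come from [prog_runs], one is to spare, and three absorb the factor 8 of
   [fib_bound]. *)
exists wgm_prog, (E + ea + 9) => I eta hI _ w _.
have B2 : 1 < nvoters I + ncands I by have := m_gt0 I; have := hI.1; lia.
have := lit_ge1; have := fib_bound (ndist I).
move: 2.619%Q => x hU x1; have x0 : (0 <= x)%R := Order.POrderTheory.le_trans
  Num.Theory.ler01 x1.
set B := nvoters I + ncands I in B2 *; set k := ndist I in hU *; set rhs := (_ * _)%R => hw.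
have hb := work_bound (E + ea + 6) B2 x0 hU; rewrite -(addnA (E + ea)) in hb.
have small e : e <= E + ea + 6 -> ((fib (2 * k + 4) * B ^ e)%:R <= rhs)%R.
  move=> le; apply: (Order.POrderTheory.le_trans _ hb).
  by rewrite Num.Theory.ler_nat leq_mul // leq_pexp2l // ltnW.
have small' e : e <= E + ea + 6 -> fib (2 * k + 4) * B ^ e <= 2 ^ w.
  by move=> le; rewrite -(Num.Theory.ler_nat rat); apply: Order.POrderTheory.le_trans
    (small e le) hw.
have U0 : 0 < fib (2 * k + 4) by rewrite addn4 fib_gt0.
case: (leqP k (nvoters I)) => [lekn|ltnk].
  have hw' : fib (2 * k + 4) * B ^ (E + ea + 4) < 2 ^ w.
    apply: leq_trans (small' (E + ea + 5) _); last by rewrite leq_add2l.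
    by rewrite ltn_pmul2l // ltn_exp2l // ltn_add2l.
  have [t [s [h1 h2 h3]]] := prog_runs eta hE hea hI lekn hw'.
  exists t, s; split=> //; apply: (Order.POrderTheory.le_trans _ (small (E + ea + 5) _)).
    by rewrite Num.Theory.ler_nat.
  by rewrite leq_add2l.
have B4 : 16 <= B ^ 4 by rewrite (@leq_exp2r 2 B 4).
have b4 : 16 <= fib (2 * k + 4) * B ^ 4 by apply: leq_trans B4 (leq_pmull _ U0).
have le4 : 4 <= E + ea + 6 by rewrite addnC.
have w3 : 3 < 2 ^ w by apply: leq_trans (small' 4 le4); apply: leq_trans b4.
have [t [s [h1 h2 h3]]] := prelude_no eta (phases 1 all_phases (Seq (compile tans
  reg0) (Set_ 0 (Reg reg0)))) ltnk w3.
exists t, s; split=> //; last by rewrite too_many.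
apply: (Order.POrderTheory.le_trans _ (small 4 le4)); rewrite Num.Theory.ler_nat.
by apply: leq_trans h2 (leq_trans _ b4).
Qed.
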